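(* There exists a real number $c>0$ such that for every $n\ge 1$ and every planar graph $G$ on $n$ vertices, $\mathcal{D}(G,\mathcal{T}_n)\le c\sqrt{n}$; i.e. there is a labeling $f:E(G)\to\{-1,1\}$ such that every spanning tree $T$ of $G$ satisfies $\left|\sum_{e\in E(T)}f(e)\right|\le c\sqrt n$.
   Context: All graphs are finite and simple. For a graph $G$, a family $\mathcal{S}_G$ of subgraphs of $G$ and $f:E(G)\to\{-1,1\}$, put $f(S)=\sum_{e\in E(S)}f(e)$ for $S\in\mathcal{S}_G$; the discrepancy is $\mathcal{D}(G,\mathcal{S}_G)=\min_f\max_{S\in\mathcal{S}_G}|f(S)|$, the minimum being over all $f:E(G)\to\{-1,1\}$ (with the maximum over an empty family taken to be $0$). $\mathcal{T}_n$ is the set of spanning trees of $G$. *)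

(* Defs.v *)
From HB Require Import structures.
From mathcomp Require Import all_boot all_order all_algebra.
From mathcomp Require Import all_classical all_reals all_analysis.
Import Order.TTheory GRing.Theory Num.Theory.
Import numFieldNormedType.Exports.

Set Implicit Arguments.
Unset Strict Implicit.
Unset Printing Implicit Defensive.

Local Open Scope classical_set_scope.
Local Open Scope ring_scope.

Record sgraph := SGraph {
  vertex :> finType;
  adj : rel vertex;
  adj_sym : symmetric adj;
  adj_irrefl : irreflexive adj }.

Definition edges (G : sgraph) : {set {set G}} :=
  [set e : {set G} |
    [exists x : G, exists y : G, adj x y && (e == [set x; y]%SET)]]%SET.

Definition edge (G : sgraph) := {e : {set G} | e \in edges G}.

(* A pair (W, F) of a vertex set and an edge set. *)
Definition subgraph_data (G : sgraph) := ({set G} * {set {set G}})%type.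

Definition is_subgraph (G : sgraph) (S : subgraph_data G) :=
  (S.2 \subset edges G) && [forall e in S.2, e \subset S.1].

Definition sub_adj (G : sgraph) (S : subgraph_data G) : rel G := fun x y => [set x; y]%SET \in S.2.

Definition is_connected (G : sgraph) (S : subgraph_data G) : Prop :=
  (exists x, x \in S.1) /\ {in S.1 &, forall x y, connect (sub_adj S) x y}.

Definition is_acyclic (G : sgraph) (S : subgraph_data G) : Prop :=
  forall s : seq G, (3 <= size s)%N -> uniq s -> ~~ cycle (sub_adj S) s.

Definition is_spanning_tree (G : sgraph) (S : subgraph_data G) : Prop :=
  [/\ is_subgraph S, S.1 = [set: G]%SET, is_connected S & is_acyclic S].

Definition spanning_trees (G : sgraph) : {set subgraph_data G} :=
  [set S : subgraph_data G | `[< is_spanning_tree S >]]%SET.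

(* Labelings E(G) -> {-1, 1}; the boolean b encodes the label (-1) ^+ b. *)
Definition labeling (G : sgraph) := {ffun edge G -> bool}.

Definition weight (G : sgraph) (f : labeling G) (S : subgraph_data G) : int :=
  \sum_(e : edge G | val e \in S.2) (-1) ^+ f e.

(* The maximum over an empty family is 0. *)
Definition max_weight (G : sgraph) (F : {set subgraph_data G})
    (f : labeling G) : nat :=
  (\max_(S in F) `|weight f S|)%N.

Definition discrepancy (G : sgraph) (F : {set subgraph_data G}) : nat :=
  max_weight F
    [arg min_(f < [ffun=> false] : labeling G) max_weight F f]%N.

Lemma discrepancy_leP (G : sgraph) (F : {set subgraph_data G}) (k : nat) :
  (discrepancy F <= k)%N <->
  exists f : labeling G, forall S, S \in F -> (`|weight f S| <= k)%N.
Proof.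
rewrite /discrepancy; case: arg_minnP => // f _ fmin; split=> [le_k|[g gP]].
  by exists f => S SF; apply: leq_trans le_k; apply: leq_bigmax_cond.
by apply: (leq_trans (fmin g isT)); apply/bigmax_leqP.
Qed.

(* A drawing in the plane: vertices are distinct points, each edge is a simple
   arc joining its two ends, and the relative interior of an arc contains no
   vertex and meets no other arc. *)
Definition is_plane_drawing (R : realType) (G : sgraph)
    (p : G -> R * R) (arc : edge G -> R -> R * R) : Prop :=
  [/\ injective p,
      forall e : edge G, {within `[0, 1], continuous (arc e)} /\
                {in `[0, 1] &, injective (arc e)},
      forall e : edge G, p @` [set x | x \in val e] = [set arc e 0; arc e 1],
      forall (e : edge G) x t, t \in `]0, 1[ -> arc e t <> p x
    & forall (e e' : edge G) s t, e != e' -> s \in `]0, 1[ -> t \in `]0, 1[ ->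
        arc e s <> arc e' t].

Definition planar (R : realType) (G : sgraph) : Prop :=
  exists (p : G -> R * R) (arc : edge G -> R -> R * R), is_plane_drawing p arc.

(* Main.v *)
(* Split the vertices as A, S, B with no edge between A and B, |A| and |B| equal
   up to |S|, and |S| = O(sqrt n), and label by -1 the edges meeting B. A
   spanning tree has n - 1 edges and at most |W| edges inside any W, so it has
   |A| + O(|S|) edges avoiding B and |B| + O(|S|) edges meeting B.

   The bisection follows by recursion from a separator theorem for graphs
   without a K5 minor. That a planar graph has no K5 minor is a parity argument
   that avoids the Jordan curve theorem: a K5 minor gives five points and curves
   joining them pairwise such that curves without common end point are disjoint.
   Replacing the curves by polylines with steps much smaller than their
   distances, disjoint curves a -> b and c -> d satisfy
     w_ab(c) + w_ab(d) + w_cd(a) + w_cd(b) = [{a,b} and {c,d} interleave] mod 2,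
   where w_ab(c) counts the passages of the first curve above c and points are
   ordered lexicographically. Summing over the 15 pairs of disjoint edges of K5
   gives 0 on the left and 5 on the right. *)
Require Import Defs.
From mathcomp Require Import all_boot all_order all_algebra.
From mathcomp Require Import zify ring lra.
Set Implicit Arguments.
Unset Strict Implicit.
Unset Printing Implicit Defensive.
Import Order.TTheory GRing.Theory Num.Theory.

(** * Separators and bisections of graphs without a clique minor *)

Section Connected.
Variables (T : finType) (e : rel T).
Hypothesis esym : symmetric e.
Implicit Types (A B D Q U X Z : {set T}) (F : {set {set T}}).

Definition restr A : rel T := fun x y => [&& e x y, x \in A & y \in A].

Definition conn A := [forall x in A, forall y in A, connect (restr A) x y].

Definition touching A B := [exists a in A, exists b in B, e a b].

(** The members of [F] are the branch sets of a complete minor on [#|F|] vertices. *)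
Definition minor_model F :=
  [/\ {in F, forall A, A != set0}, {in F, forall A, conn A},
      {in F &, forall A B, A != B -> [disjoint A & B]}
    & {in F &, forall A B, A != B -> touching A B}].

Lemma connP A : reflect {in A &, forall x y, connect (restr A) x y} (conn A).
Proof.
apply: (iffP forall_inP) => [H x y xA yA | H x xA].
  by have /forall_inP := H x xA; apply.
by apply/forall_inP => y yA; apply: H.
Qed.

Lemma touchingP A B :
  reflect (exists a b, [/\ a \in A, b \in B & e a b]) (touching A B).
Proof.
apply: (iffP exists_inP) => [[a aA /exists_inP[b bB ab]] | [a [b [aA bB ab]]]].
  by exists a, b.
by exists a => //; apply/exists_inP; exists b.
Qed.

Lemma touching_sym A B : touching A B = touching B A.
Proof.
apply/touchingP/touchingP => -[a [b [aA bB ab]]]; exists b, a;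
  by rewrite esym.
Qed.

Lemma touchingSl A A' B : A \subset A' -> touching A B -> touching A' B.
Proof.
move=> /subsetP sA /touchingP[a [b [aA bB ab]]].
by apply/touchingP; exists a, b; rewrite sA.
Qed.

Lemma restr_connect_sym A : connect_sym (restr A).
Proof.
by apply: sym_connect_sym => x y; rewrite /restr esym [(y \in A) && _]andbC.
Qed.

Lemma restrS A B x y : A \subset B -> connect (restr A) x y -> connect (restr B) x y.
Proof.
move=> /subsetP sAB; apply: connect_sub => u v /and3P[uv uA vA].
by apply: connect1; rewrite /restr uv !sAB.
Qed.

Lemma connect_restr_closed A B x y :
    connect (restr A) x y -> x \in B ->
    (forall u v, u \in A -> u \in B -> v \in A -> e u v -> v \in B) -> y \in B.
Proof.
move=> /connectP[p + ->] xB clB; elim: p x xB => //= z p IHp x xB /andP[].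
by move=> /and3P[xz xA zA]; apply: IHp; apply: clB xz.
Qed.

Lemma conn_subset A B x :
    conn A -> x \in A -> x \in B ->
    (forall u v, u \in A -> u \in B -> v \in A -> e u v -> v \in B) -> A \subset B.
Proof.
move=> /connP cA xA xB clB; apply/subsetP => y yA.
exact: connect_restr_closed (cA x y xA yA) xB clB.
Qed.

Lemma conn1 x : conn [set x].
Proof. by apply/connP => y z /set1P-> /set1P->; apply: connect0. Qed.

Lemma conn_hub A x : {in A, forall y, connect (restr A) x y} -> conn A.
Proof.
move=> H; apply/connP => y z yA zA.
by apply: (connect_trans (y := x)); [rewrite restr_connect_sym|]; apply: H.
Qed.

Lemma connU A B x : conn A -> conn B -> x \in A -> x \in B -> conn (A :|: B).
Proof.
move=> /connP cA /connP cB xA xB; apply: (@conn_hub _ x) => y /setUP[yA|yB].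
  by apply: restrS (cA _ _ xA yA); apply: subsetUl.
by apply: restrS (cB _ _ xB yB); apply: subsetUr.
Qed.

Lemma connU_touch A B : conn A -> conn B -> touching A B -> conn (A :|: B).
Proof.
move=> /connP cA /connP cB /touchingP[a [b [aA bB ab]]].
apply: (@conn_hub _ a) => y /setUP[yA|yB].
  by apply: restrS (cA _ _ aA yA); apply: subsetUl.
apply: connect_trans (restrS (subsetUr _ _) (cB _ _ bB yB)).
by apply: connect1; rewrite /restr ab !inE aA bB orbT.
Qed.

Definition component A x := [set y in A | connect (restr A) x y].

Lemma component_sub A x : component A x \subset A.
Proof. by apply/subsetP => y; rewrite inE => /andP[]. Qed.

Lemma mem_component A x : x \in A -> x \in component A x.
Proof. by rewrite inE connect0 andbT. Qed.

Lemma component_closed A x u v : u \in component A x -> v \in A -> e u v -> v \in component A x.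
Proof.
rewrite !inE => /andP[uA xu] vA uv; rewrite vA /=.
by apply: connect_trans xu _; apply: connect1; rewrite /restr uv uA.
Qed.

Lemma conn_component A x : x \in A -> conn (component A x).
Proof.
move=> xA; apply: (@conn_hub _ x) => y; rewrite inE => /andP[yA xy].
pose B := [set z | connect (restr (component A x)) x z].
suff: y \in B by rewrite inE.
apply: connect_restr_closed xy _ _ => [|u v uA]; rewrite !inE ?connect0 // => xu vA uv.
have uC : u \in component A x.
  by rewrite inE uA; apply: restrS xu; apply: component_sub.
apply: connect_trans xu _; apply: connect1.
by rewrite /restr uv uC; apply: component_closed uv.
Qed.

Fixpoint graph_ball D A j :=
  if j is j'.+1 then
    graph_ball D A j' :|: [set v in D | [exists u in graph_ball D A j', e u v]]
  else A.

Lemma graph_ballS D A i j : i <= j -> graph_ball D A i \subset graph_ball D A j.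
Proof.
move=> /subnKC <-; elim: (j - i) => [|k IHk]; first by rewrite addn0.
by rewrite addnS; apply: subset_trans IHk (subsetUl _ _).
Qed.

Lemma graph_ball_sub D A j : A \subset D -> graph_ball D A j \subset D.
Proof.
move=> sAD; elim: j => //= j IHj; rewrite subUset IHj /=.
by apply/subsetP => v; rewrite inE => /andP[].
Qed.

(** [P] is the vertex set of a path from [v] back to [A] that gains at most one vertex per unit of
    radius. *)
Lemma graph_ball_path D A j v : A \subset D -> v \in graph_ball D A j ->
  exists P, [/\ conn P, P \subset D, v \in P, ~~ [disjoint P & A] & #|P| <= j.+1].
Proof.
move=> sAD; elim: j v => [|j IHj] v /=.
  move=> vA; exists [set v]; rewrite conn1 sub1set (subsetP sAD) // set11 cards1.
  by split=> //; apply/pred0Pn; exists v; rewrite /= set11.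
case/setUP=> [/IHj[P [cP PD vP PA leP]]|]; first by exists P; split=> //; apply: leqW.
rewrite inE => /andP[vD /exists_inP[u /IHj[P [cP PD uP /pred0Pn[w /andP[/= wP wA]] leP]] uv]].
exists ([set v] :|: P); split.
- apply: connU_touch (conn1 v) cP _; apply/touchingP; exists v, u.
  by rewrite set11 esym.
- by rewrite subUset sub1set vD.
- by rewrite !inE eqxx.
- by apply/pred0Pn; exists w; rewrite /= wA !inE wP orbT.
- by rewrite cardsU1; case: (v \notin P) => //=; rewrite ?add0n ?add1n // leqW.
Qed.

(** Pigeonhole: the first [r] distance levels around [A] are disjoint subsets of [D]. *)
Lemma thin_level D A r : A \subset D -> 0 < r ->
  exists2 j, j < r & #|graph_ball D A j.+1 :\: graph_ball D A j| * r <= #|D|.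
Proof.
move=> sAD r0.
have sumE k : \sum_(j < k) #|graph_ball D A j.+1 :\: graph_ball D A j| <= #|graph_ball D A k|.
  elim: k => [|k IHk]; first by rewrite big_ord0.
  rewrite big_ord_recr -(cardsID (graph_ball D A k) (graph_ball D A k.+1)) leq_add2r.
  by rewrite (setIidPr (graph_ballS D A (leqnSn k))).
case: (pickP [pred j : 'I_r |
    #|graph_ball D A j.+1 :\: graph_ball D A j| * r <= #|D|]) => [j jP|no].
  by exists j.
suff : #|D| * r < #|D| * r by rewrite ltnn.
apply: leq_trans (leq_mul (leq_trans (sumE r) (subset_leq_card (graph_ball_sub r sAD))) (leqnn r)).
rewrite big_distrl /=; apply: (@leq_trans (\sum_(j < r) #|D|.+1)); last first.
  by apply: leq_sum => j _; have := no j; rewrite /= ltnNge => ->.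
rewrite sum_nat_const card_ord; nia.
Qed.

(** Once the level at distance [j + 1] is deleted from [D], no edge leads out of the ball of radius
    [j]. *)
Lemma conn_in_ball D A j Q :
    conn Q -> Q \subset D :\: (graph_ball D A j.+1 :\: graph_ball D A j) -> A \subset D ->
  ~~ [disjoint Q & A] -> Q \subset graph_ball D A j.
Proof.
move=> cQ /subsetP QD sAD /pred0Pn[x /andP[/= xQ xA]].
apply: conn_subset cQ xQ _ _; first exact: subsetP (graph_ballS D A (leq0n j)) _ xA.
move=> u v uQ uB vQ uv; have := QD v vQ; rewrite !inE /=.
case: (v \in graph_ball D A j) => //=; case: (v \in D); rewrite ?andbF //= andbT.
by case/existsP; exists u; rewrite uB.
Qed.

(* A vertex at distance at most r from every A i is the hub of a small
   connected set meeting them all; if there is none, one thin distance level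
   around each A i can be removed. *)
Lemma hub_or_cut (I : finType) (F : {set I}) (A : I -> {set T}) D r :
    0 < r -> D != set0 -> {in F, forall i, A i \subset D} ->
  (exists P, [/\ conn P, P \subset D, P != set0, #|P| <= 1 + #|F| * r.+1
     & {in F, forall i, ~~ [disjoint P & A i]}]) \/
  (exists Z, [/\ Z \subset D, #|Z| * r <= #|F| * #|D|
     & forall Q, conn Q -> Q \subset D :\: Z -> Q != set0 ->
         exists2 i, i \in F & [disjoint Q & A i]]).
Proof.
move=> r0 D0 AD.
case: (pickP [pred v in D | [forall i in F, v \in graph_ball D (A i) r]]) => [v|no].
  move=> /andP[/= vD /forall_inP vB]; left.
  have pathP i : exists P, [&& conn P, P \subset D, v \in P &
      (i \in F) ==> ~~ [disjoint P & A i] && (#|P| <= r.+1)].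
    have [iF|] := boolP (i \in F); last first.
      by exists [set v]; rewrite conn1 sub1set vD set11.
    have [P [cP PD vP PA leP]] := graph_ball_path (AD i iF) (vB i iF).
    by exists P; rewrite cP PD vP PA leP.
  pose P i := xchoose (pathP i).
  have PP i : [&& conn (P i), P i \subset D, v \in P i &
      (i \in F) ==> ~~ [disjoint P i & A i] && (#|P i| <= r.+1)] := xchooseP (pathP i).
  exists ([set v] :|: \bigcup_(i in F) P i); split.
  - have: conn ([set v] :|: \bigcup_(i in F) P i) /\
          v \in [set v] :|: \bigcup_(i in F) P i.
      elim/big_rec: _ => [|i B iF [cB vB']]; first by rewrite setU0 conn1 set11.
      have /and4P[cP _ vP _] := PP i.
      by rewrite setUCA; split; [apply: connU cP cB vP vB' | rewrite inE vP].
    by case.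
  - rewrite subUset sub1set vD; apply/bigcupsP => i _.
    by have /and4P[] := PP i.
  - by apply/set0Pn; exists v; rewrite !inE eqxx.
  - apply: leq_trans (leq_card_setU _ _) _; rewrite cards1 leq_add2l.
    apply: (@leq_trans (\sum_(i in F) #|P i|)); last first.
      rewrite -sum_nat_const; apply: leq_sum => i iF.
      by have /and4P[_ _ _] := PP i; rewrite iF => /andP[].
    elim/big_rec2: _ => [|i n B iF leB]; first by rewrite cards0.
    by apply: leq_trans (leq_card_setU _ _) _; rewrite leq_add2l.
  - move=> i iF; have /and4P[_ _ _] := PP i; rewrite iF => /andP[/pred0Pn[w /andP[/= wP wA]] _].
    apply/pred0Pn; exists w; rewrite /= wA andbT inE; apply/orP; right.
    by apply/bigcupP; exists i.
right.
have levelP i : exists j, (i \in F) ==> (j < r) &&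
    (#|graph_ball D (A i) j.+1 :\: graph_ball D (A i) j| * r <= #|D|).
  have [iF|] := boolP (i \in F); last by exists 0.
  by have [j jr leD] := thin_level (AD i iF) r0; exists j; rewrite jr.
pose J i := ex_minn (levelP i).
have JP i : i \in F -> (J i < r) &&
    (#|graph_ball D (A i) (J i).+1 :\: graph_ball D (A i) (J i)| * r <= #|D|).
  by rewrite /J; case: ex_minnP => j jP _ iF; rewrite iF in jP.
pose L i := graph_ball D (A i) (J i).+1 :\: graph_ball D (A i) (J i).
exists (\bigcup_(i in F) L i); split.
- apply/bigcupsP => i iF; apply: subset_trans (subsetDl _ _) _.
  exact: graph_ball_sub (AD i iF).
- rewrite -[X in _ <= X]sum_nat_const.
  apply: (@leq_trans ((\sum_(i in F) #|L i|) * r)).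
    apply: leq_mul => //.
    elim/big_rec2: _ => [|i n B iF leB]; first by rewrite cards0.
    by apply: leq_trans (leq_card_setU _ _) _; rewrite leq_add2l.
  by rewrite big_distrl /=; apply: leq_sum => i /JP/andP[].
move=> Q cQ QD /set0Pn[v vQ].
case: (pickP [pred i in F | [disjoint Q & A i]]) => [i /andP[/= iF dis]|meet].
  by exists i.
(* A set [Q] meeting every [A i] would lie in all the balls of radius [J i < r], so its vertex [v]
   would be a hub, against [no]. *)
have vD : v \in D by have := subsetP QD v vQ; rewrite inE => /andP[].
have /negP[] := negbT (no v); rewrite /= vD /=; apply/forall_inP => i iF.
have /andP[jr _] := JP i iF.
apply: (subsetP (graph_ballS D (A i) (ltnW jr))).
have := meet i; rewrite /= iF /= => /negbT mQ.
have sQ : Q \subset D :\: L i.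
  apply: subset_trans QD _; apply: setDS; exact: bigcup_sup.
exact: subsetP (conn_in_ball cQ sQ (AD i iF) mQ) v vQ.
Qed.


(** Two subsets with more than half of [U] intersect; from a common vertex the connected set [D],
    which avoids [X], cannot leave [E]. *)
Lemma big_conn_sub U X D (E : {set T}) :
    #|U| < 2 * #|D| -> #|U| < 2 * #|E| -> D \subset U -> E \subset U ->
    conn D -> [disjoint D & X] ->
    (forall u v, u \in E -> v \in U -> e u v -> v \notin X -> v \in E) ->
  D \subset E.
Proof.
move=> ltD ltE DU EU cD DX clE.
have /pred0Pn[x /andP[/= xD xE]] : ~~ [disjoint D & E].
  apply/negP => dis; have := subset_leq_card (_ : D :|: E \subset U).
  rewrite subUset DU EU => /(_ isT); move: dis; rewrite -leq_card_setU => /eqP->.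
  lia.
apply: conn_subset cD xD xE _ => u v uD uE vD uv.
by apply: clE uE (subsetP DU v vD) uv _; rewrite (disjointFr DX vD).
Qed.

(** * Clique minors in sets without a small balanced separator *)

Section Separator.
Variables (U : {set T}) (h q r : nat).
Hypotheses (h0 : 0 < h) (r0 : 0 < r).
(** For fewer than [h] sets, [hubq] and [cutq] bound by [q] the hub and the cut given by
    [hub_or_cut]. *)
Hypotheses (hubq : 1 + h.-1 * r.+1 <= q) (cutq : h.-1 * #|U| <= q * r).

Hypothesis big : forall X, X \subset U -> #|X| <= h * q ->
  exists D, [/\ conn D, D \subset U :\: X, #|U| < 2 * #|D|
    & forall u v, u \in D -> v \in U -> e u v -> v \notin X -> v \in D].

(** With second coordinates at most [h], [d * h.+1 + f] encodes the lexicographic order on pairs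
    [(d, f)]. *)
Lemma lex_measure_lt d d' f f' N :
  d * h.+1 + f < N.+1 -> d' < d -> f' <= h -> d' * h.+1 + f' < N.
Proof. by clear; nia. Qed.

(* The argument of Alon, Seymour and Thomas. F is a clique minor under
   construction, X takes at most q vertices from each member of F, and D is the
   big component of U minus X. A small connected set meeting the neighbourhoods
   of all members of F is added to F; otherwise a small cut Z leaves a big
   component D0' missing the neighbours of some A in F, and A absorbs the set R
   of what it reaches outside D0', which makes D smaller. *)
Lemma minor_of_big_components_rec N F X D :
    #|D| * h.+1 + #|F| < N -> #|F| < h ->
    minor_model F -> {in F, forall A, A \subset U} -> {in F, forall A, [disjoint A & D]} ->
    X \subset cover F -> {in F, forall A, #|X :&: A| <= q} ->
    conn D -> D \subset U :\: X -> #|U| < 2 * #|D| ->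
    (forall u v, u \in D -> v \in U -> e u v -> v \notin X -> v \in D) ->
  exists F', minor_model F' /\ #|F'| = h.
Proof.
elim: N F X D => // N IHN F X D ltN Fh [F0 Fc Fd Ft] FU FD XF Xq cD DU ltD clD.
have DU' : D \subset U by apply: subset_trans DU (subsetDl _ _).
have DX : [disjoint D & X] by move: DU; rewrite subsetD => /andP[].
have XU : X \subset U.
  by apply: subset_trans XF _; apply/bigcupsP => A /FU.
have cardX : forall F' X', X' \subset cover F' ->
    {in F', forall A, #|X' :&: A| <= q} -> #|X'| <= #|F'| * q.
  move=> F' X' sX' leq'.
  rewrite -[X in _ <= X]sum_nat_const -(setIidPl sX').
  rewrite /cover big_distrr /=.
  apply: (@leq_trans (\sum_(A in F') #|X' :&: A|)); last exact: leq_sum.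
  elim/big_rec2: _ => [|i n B iF leB]; first by rewrite cards0.
  by apply: leq_trans (leq_card_setU _ _) _; rewrite leq_add2l.
have D0 : D != set0 by rewrite -card_gt0; move: ltD; clear; lia.
(* A member without neighbours in [D] is dropped with its share of [X]: [D] stays closed, and the
   measure falls in its second coordinate. *)
case: (pickP [pred A in F | ~~ touching A D]) => [A /andP[/= AF nt]|allt].
  have sF : {subset F :\ A <= F} by move=> B /setD1P[].
  apply: (IHN (F :\ A) (X :\: A) D) => //.
  - by move: ltN; rewrite (cardsD1 A F) AF addnCA add1n ltnS.
  - by apply: leq_ltn_trans Fh; apply: subset_leq_card; apply: subsetDl.
  - by split=> [B /sF/F0|B /sF/Fc|B C /sF BF /sF|B C /sF BF /sF] //; [apply: Fd|apply: Ft].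
  - by move=> B /sF/FU.
  - by move=> B /sF/FD.
  - apply/subsetP => x /setDP[/(subsetP XF)/bigcupP[B BF xB] xA].
    apply/bigcupP; exists B => //; rewrite !inE BF andbT.
    by apply: contraNneq xA => <-.
  - move=> B /sF BF; apply: leq_trans (Xq B BF); apply: subset_leq_card.
    by rewrite setSI // subsetDl.
  - rewrite subsetD DU'; apply: disjointWr DX; exact: subsetDl.
  - move=> u v uD vU uv; rewrite !inE negb_and negbK => /orP[vA|vX].
      case/negP: nt; apply/touchingP; exists v, u; by rewrite esym.
    exact: clD uv vX.
pose N_ A := [set v in D | [exists a in A, e a v]].
have ND A : A \in F -> N_ A \subset D.
  by move=> _; apply/subsetP => v; rewrite inE => /andP[].
have N0 A : A \in F -> exists2 v, v \in D & v \in N_ A.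
  move=> AF; have := allt A; rewrite /= AF => /negbFE/touchingP[a [b [aA bD ab]]].
  by exists b => //; rewrite inE bD; apply/exists_inP; exists a.
case: (hub_or_cut r0 D0 ND) => [[P [cP PD P0 leP PN]]|[Z [ZD leZ ZN]]].
- have sP : #|P| <= q.
    by apply: leq_trans leP (leq_trans _ hubq); rewrite leq_add2l leq_mul // -ltnS prednK.
  have Pt A : A \in F -> touching P A.
    move=> AF; have /pred0Pn[v /andP[/= vP]] := PN A AF.
    rewrite inE => /andP[_ /exists_inP[a aA av]].
    by apply/touchingP; exists v, a; rewrite esym.
  have Pd A : A \in F -> [disjoint P & A].
    by move=> AF; rewrite disjoint_sym; apply: disjointWr PD (FD A AF).
  have PF : P \notin F.
    apply/negP => PF; have := Pd P PF; case/set0Pn: P0 => x xP.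
    by move/pred0P/(_ x); rewrite /= xP.
  have mP : minor_model (P |: F).
    split=> [A /setU1P[->//|/F0//]|A /setU1P[->//|/Fc//]|A B|A B].
      move=> /setU1P[->|AF] /setU1P[->|BF]; rewrite ?eqxx //; first by rewrite Pd.
        by rewrite disjoint_sym Pd.
      exact: Fd.
    move=> /setU1P[->|AF] /setU1P[->|BF]; rewrite ?eqxx //; first by rewrite Pt.
      by rewrite touching_sym Pt.
    exact: Ft.
  have cPF : #|P |: F| = #|F|.+1 by rewrite cardsU1 PF.
  (* Either [P] completes the minor, or [P] also joins [X], which forces the next big component
     strictly inside [D]. *)
  have [Fh'|] := eqVneq #|F|.+1 h.
    by exists (P |: F); rewrite cPF.
  move=> Fh'.
  have sXP : X :|: P \subset cover (P |: F).
    by rewrite /cover bigcup_setU big_set1 setUC setUS.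
  have XPq : {in P |: F, forall A, #|(X :|: P) :&: A| <= q}.
    move=> A /setU1P[->|AF].
      rewrite setIUl setIid; have -> : X :&: P = set0.
        apply/eqP; rewrite setI_eq0 disjoint_sym; exact: disjointWl PD DX.
      by rewrite set0U.
    rewrite setIUl; have -> : P :&: A = set0 by apply/eqP; rewrite setI_eq0 Pd.
    by rewrite setU0 Xq.
  have PU : P |: F \subset P |: F by [].
  have XPU : X :|: P \subset U by rewrite subUset XU (subset_trans PD).
  have [|D' [cD' D'U ltD' clD']] := big XPU.
    apply: leq_trans (cardX _ _ sXP XPq) _; rewrite cPF leq_mul2r; apply/orP; right; exact: Fh.
  have D'U' : D' \subset U by apply: subset_trans D'U (subsetDl _ _).
  have D'XP : [disjoint D' & X :|: P] by move: D'U; rewrite subsetD => /andP[].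
  have D'D : D' \subset D.
    apply: big_conn_sub ltD' ltD D'U' DU' cD' _ clD.
    by apply: disjointWr D'XP; apply: subsetUl.
  have ltDD : #|D'| < #|D|.
    apply: proper_card; rewrite properE D'D; apply/negP => DD'.
    case/set0Pn: P0 => x xP; have := disjointFr D'XP (subsetP DD' x (subsetP PD x xP)).
    by rewrite inE xP orbT.
  apply: (IHN (P |: F) (X :|: P) D') => //; first by rewrite cPF; apply: lex_measure_lt ltN ltDD Fh.
  - by rewrite cPF ltn_neqAle Fh'.
  - move=> A /setU1P[->|/FU//]; exact: subset_trans PD DU'.
  - move=> A /setU1P[->|/FD AD].
      by rewrite disjoint_sym; apply: disjointWr D'XP; apply: subsetUr.
    exact: disjointWr D'D AD.
- have leZq : #|Z| <= q.
    have := subset_leq_card DU'; move=> leDU.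
    suff : #|Z| * r <= q * r by rewrite leq_pmul2r.
    by apply: leq_trans leZ (leq_trans _ cutq); apply: leq_mul => //; rewrite -ltnS prednK.
  have leX := cardX F X XF Xq.
  have XZU : X :|: Z \subset U by rewrite subUset XU (subset_trans ZD).
  have [|D0' [cD0 D0U ltD0 clD0]] := big XZU.
    apply: leq_trans (leq_card_setU _ _) _; move: leZq leX Fh; clear; nia.
  have D0U' : D0' \subset U by apply: subset_trans D0U (subsetDl _ _).
  have D0XZ : [disjoint D0' & X :|: Z] by move: D0U; rewrite subsetD => /andP[].
  have D0D : D0' \subset D.
    apply: big_conn_sub ltD0 ltD D0U' DU' cD0 _ clD.
    by apply: disjointWr D0XZ; apply: subsetUl.
  have D0nZ : D0' \subset D :\: Z.
    by rewrite subsetD D0D; apply: disjointWr D0XZ; apply: subsetUr.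
  have D00 : D0' != set0 by rewrite -card_gt0; move: ltD0; clear; lia.
  have [A AF disA] := ZN D0' cD0 D0nZ D00.
  (* [D0'] contains no neighbour of [A], so [R] contains all neighbours of [A] in [D], and no edge
     joins [R] to the rest of [D :\: D0']. *)
  pose R := [set v in D :\: D0' | [exists a in N_ A, connect (restr (D :\: D0')) a v]].
  have NR : N_ A \subset R.
    apply/subsetP => v vN; rewrite inE inE (subsetP (ND A AF)) // andbT.
    rewrite (disjointFl disA) //=; apply/exists_inP; exists v => //.
  have RD : R \subset D by apply/subsetP => v; rewrite inE => /andP[/setDP[]].
  have clR u v : u \in R -> v \in D :\: D0' -> e u v -> v \in R.
    rewrite [u \in R]inE [v \in R]inE => /andP[uD /exists_inP[a aN au]] vD uv.
    rewrite vD /=; apply/exists_inP; exists a => //.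
    by apply: connect_trans au _; apply: connect1; rewrite /restr uv uD.
  pose A' := A :|: R.
  have AD := FD A AF.
  have cA' : conn A'.
    have /set0Pn[a0 a0A] := F0 A AF.
    apply: (@conn_hub _ a0) => y /setUP[yA|].
      by apply: restrS (connP _ (Fc A AF) _ _ a0A yA); apply: subsetUl.
    rewrite inE => /andP[yD /exists_inP[a aN ay]].
    have aN' := aN; move: aN; rewrite inE => /andP[aD /exists_inP[b bA ba]].
    have ARa : a \in A' by rewrite inE (subsetP NR) // orbT.
    apply: (connect_trans (y := b)).
      by apply: restrS (connP _ (Fc A AF) _ _ a0A bA); apply: subsetUl.
    apply: (connect_trans (y := a)).
      by apply: connect1; rewrite /restr ba ARa inE bA.
    have aDD : a \in D :\: D0'.
      by have := subsetP NR a aN'; rewrite [a \in R]inE => /andP[].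
    pose B := [set z in R | connect (restr A') a z].
    suff : y \in B by rewrite inE => /andP[].
    apply: connect_restr_closed ay _ _.
      by rewrite inE connect0 (subsetP NR).
    move=> u v uD; rewrite inE => /andP[uR au] vD uv; rewrite inE.
    have vR := clR u v uR vD uv; rewrite vR /=.
    by apply: connect_trans au _; apply: connect1; rewrite /restr uv /A' !in_setU uR vR !orbT.
  have sF : {subset F :\ A <= F} by move=> B /setD1P[].
  have dA' B : B \in F :\ A -> [disjoint A' & B].
    move=> /setD1P[BA BF]; rewrite -setI_eq0 setIUl setU_eq0 !setI_eq0 Fd //=;
      last by rewrite eq_sym.
    by rewrite disjoint_sym; apply: disjointWr RD (FD B BF).
  have tA' B : B \in F :\ A -> touching A' B.
    move=> /setD1P[BA BF]; apply: touchingSl (subsetUl _ _) _.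
    by apply: Ft => //; rewrite eq_sym.
  have A'F : A' \notin F :\ A.
    apply/negP => /dA'; have /set0Pn[a aA] := F0 A AF.
    by move/pred0P/(_ a); rewrite /= inE aA.
  pose F' := A' |: F :\ A.
  have cF' : #|F'| = #|F| by rewrite /F' cardsU1 A'F [in RHS](cardsD1 A) AF.
  have mF' : minor_model F'.
    split=> [B /setU1P[->|/sF/F0//]|B /setU1P[->//|/sF/Fc//]|B C|B C].
    - have /set0Pn[a aA] := F0 A AF; apply/set0Pn; exists a; by rewrite inE aA.
    - move=> /setU1P[->|BF] /setU1P[->|CF]; rewrite ?eqxx //; first by rewrite dA'.
        by rewrite disjoint_sym dA'.
      by apply: Fd; apply: sF.
    - move=> /setU1P[->|BF] /setU1P[->|CF]; rewrite ?eqxx //; first by rewrite tA'.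
        by rewrite touching_sym tA'.
      by apply: Ft; apply: sF.
  (* No vertex of [D :\: R] has a neighbour in [A], so the old share of [A] can be released. Edges
     from [R] to [D0'] start in [Z], hence the new share [Z :&: R]. *)
  pose X' := (X :\: A) :|: (Z :&: R).
  have X'F' : X' \subset cover F'.
    rewrite /F' /cover bigcup_setU big_set1; apply/subsetP => x /setUP[/setDP[xX xA]|].
      have /bigcupP[B BF xB] := subsetP XF x xX.
      rewrite inE; apply/orP; right; apply/bigcupP; exists B => //.
      by rewrite !inE BF andbT; apply: contraNneq xA => <-.
    by rewrite in_setI in_setU /A' in_setU => /andP[_ ->]; rewrite orbT.
  have X'q : {in F', forall B, #|X' :&: B| <= q}.
    move=> B /setU1P[->|BF].
      apply: leq_trans leZq; apply: subset_leq_card.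
      apply/subsetP => x; rewrite /X' /A' !(in_setU, in_setI, in_setD).
      case/andP=> /orP[/andP[/negPf-> xX] /= xR|/andP[]//].
      by rewrite (disjointFr DX) // (subsetP RD) in xX.
    apply: leq_trans (Xq B (sF _ BF)); apply: subset_leq_card.
    apply/subsetP => x; rewrite /X' !(in_setU, in_setI, in_setD).
    case/andP=> /orP[/andP[_ ->]//|/andP[_ xR]] xB.
    by have := disjointFr (dA' B BF) (_ : x \in A'); rewrite in_setU xR orbT xB => /(_ isT).
  have X'U : X' \subset U.
    rewrite subUset (subset_trans (subsetDl _ _) XU) /=.
    by apply: subset_trans (subsetIr _ _) (subset_trans RD DU').
  have [|D' [cD' D'U ltD' clD']] := big X'U.
    apply: leq_trans (cardX _ _ X'F' X'q) _; rewrite cF' leq_mul2r; apply/orP; right; exact: ltnW.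
  have D'U' : D' \subset U by apply: subset_trans D'U (subsetDl _ _).
  have D'X' : [disjoint D' & X'] by move: D'U; rewrite subsetD => /andP[].
  have D0R : D0' \subset D :\: R.
    rewrite subsetD D0D; apply/pred0P => x /=; apply/negP => /andP[xD0].
    by rewrite inE => /andP[/setDP[_ /negP]].
  (* [D :\: R] contains [D0'], hence more than half of [U], and it is closed outside [X']. *)
  have D'D : D' \subset D :\: R.
    apply: big_conn_sub ltD' _ D'U' _ cD' D'X' _.
      by apply: leq_trans ltD0 _; rewrite leq_mul2l subset_leq_card.
      by apply: subset_trans (subsetDl _ _) DU'.
    move=> u v /setDP[uD uR] vU uv vX'.
    have vA : v \notin A.
      apply: contra uR => vA; apply: (subsetP NR); rewrite inE uD.
      by apply/exists_inP; exists v => //; rewrite esym.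
    move: (vX'); rewrite /X' !(in_setU, in_setI, in_setD) vA /= negb_or negb_and => /andP[vX vZR].
    have vD := clD u v uD vU uv vX; rewrite vD andbT; apply/negP => vR.
    rewrite vR orbF in vZR.
    have [uD0|uD0] := boolP (u \in D0').
      have := clD0 u v uD0 vU uv; rewrite in_setU (negPf vX) (negPf vZR) => /(_ isT).
      by move: vR; rewrite inE => /andP[/setDP[_ /negPf->]].
    by case/negP: uR; apply: clR vR _ _; rewrite ?inE ?uD ?uD0 // esym.
  have ltDD : #|D'| < #|D|.
    apply: proper_card; rewrite properE (subset_trans D'D (subsetDl _ _)).
    have [v vD /(subsetP NR) vR] := N0 A AF.
    by apply/subsetPn; exists v => //; apply/negP => /(subsetP D'D); rewrite in_setD vR.
  apply: (IHN F' X' D') => //; rewrite ?cF' //.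
  - exact: lex_measure_lt ltN ltDD (ltnW Fh).
  - move=> B /setU1P[->|/sF/FU//]; rewrite subUset FU //=; exact: subset_trans RD DU'.
  - move=> B /setU1P[->|/sF/FD BD]; last exact: disjointWr (subset_trans D'D (subsetDl _ _)) BD.
    rewrite -setI_eq0 setIUl setU_eq0 !setI_eq0.
    rewrite (disjointWr (subset_trans D'D (subsetDl _ _)) AD) /=.
    by rewrite disjoint_sym; move: D'D; rewrite subsetD => /andP[].
Qed.


Lemma minor_of_big_components : exists F, minor_model F /\ #|F| = h.
Proof.
have [||D [cD DU ltD clD]] := @big set0; rewrite ?sub0set ?cards0 //.
apply: (@minor_of_big_components_rec _ set0 set0 D (leqnn _)) => //.
- by rewrite cards0.
- by split=> A; rewrite inE.
- by move=> A; rewrite inE.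
- by move=> A; rewrite inE.
- by rewrite sub0set.
- by move=> A; rewrite inE.
Qed.

End Separator.

(** * Balanced separators and bisections *)

Section Bisection.
Variable h : nat.
Hypotheses (h0 : 0 < h) (no_minor : forall F, minor_model F -> #|F| <> h).

(** Otherwise every deletion of at most [h * q] vertices would leave a component with more than half
    of [U], which yields the excluded minor. *)
Lemma separator U : exists X,
  [/\ X \subset U, #|X| ^ 2 <= (4 * h ^ 2) ^ 2 * #|U|
    & forall Q, conn Q -> Q \subset U :\: X -> 2 * #|Q| <= #|U|].
Proof.
have [U0|U0] := posnP #|U|.
  exists set0; split; rewrite ?sub0set ?cards0 // => Q _.
  by rewrite setD0 => /subset_leq_card; rewrite U0; case: #|Q|.
have ex_r : exists r, #|U| <= r ^ 2 by exists #|U|; rewrite -{1}[#|U|]muln1 leq_mul.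
(* [r] is the square root of [#|U|] rounded up; rounding at most doubles it, whence [r4]. *)
case: (ex_minnP ex_r) => r Ur minr.
have r0 : 0 < r by case: r Ur {minr} => //; rewrite leqNgt U0.
have r4 : r ^ 2 <= 4 * #|U|.
  case: r r0 Ur minr => // -[|r] _ _ minr; first by move: U0; clear; lia.
  have := contraNN (minr r.+1); rewrite ltnn => /(_ isT).
  by rewrite -ltnNge; clear; nia.
(* Large enough for the hub bound [1 + h.-1 * r.+1 <= q] and, as [#|U| <= r ^ 2], for the cut
   bound. *)
pose q := 2 * h * r.
case: (boolP [exists X : {set T}, [&& X \subset U, #|X| <= h * q
    & [forall Q : {set T}, conn Q && (Q \subset U :\: X) ==> (2 * #|Q| <= #|U|)]]]).
  case/existsP=> X /and3P[XU leX /forallP XQ]; exists X; split=> // [|Q cQ QU].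
    apply: (@leq_trans ((h * q) ^ 2)); first by rewrite leq_exp2r.
    have -> : (h * q) ^ 2 = (2 * h ^ 2) ^ 2 * r ^ 2 by rewrite /q; clear; ring.
    apply: leq_trans (leq_mul (leqnn _) r4) _.
    by rewrite mulnA leq_mul2r; apply/orP; right; clear; nia.
  by have := XQ Q; rewrite cQ QU.
rewrite negb_exists => /forallP none.
have [||X XU leX|F [mF /no_minor[]//]] := @minor_of_big_components U h q r h0 r0.
- by rewrite /q; move: h0 r0; clear; case: h => // k _; nia.
- apply: leq_trans (leq_mul (leq_pred h) Ur) _; rewrite /q; clear; nia.
have := none X; rewrite XU leX /= negb_forall => /existsP[Q].
rewrite negb_imply -ltnNge => /andP[/andP[cQ QU] ltQ].
have /set0Pn[x xQ] : Q != set0 by rewrite -card_gt0; move: ltQ; clear; lia.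
have xUX := subsetP QU x xQ.
exists (component (U :\: X) x); split.
- exact: conn_component.
- exact: component_sub.
- apply: leq_trans ltQ _; rewrite leq_mul2l subset_leq_card //.
  apply: conn_subset cQ xQ (mem_component xUX) _ => u v _ uC vQ uv.
  exact: component_closed uC (subsetP QU v vQ) uv.
- move=> u v uC vU uv vX; apply: component_closed uC _ uv; by rewrite inE vX.
Qed.

(** The free target [t] permits recursion: after deletion of a separator, whole components go to [A]
    until one overflows, and only that one, with at most half of the vertices, is split again. The
    separators shrink by a factor of [sqrt 2] each time, so their sum is less than 4 times the first
    bound. *)
Lemma bisection U t : t <= #|U| -> exists A B,
  [/\ A \subset U, B \subset U, [disjoint A & B] & ~~ touching A B] /\
  [/\ #|A| <= t, #|B| <= #|U| - t
    & #|U :\: (A :|: B)| ^ 2 <= (16 * h ^ 2) ^ 2 * #|U|].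
Proof.
have [n] := ubnP #|U|; elim: n U t => // n IHn U t ltU tU.
have [X [XU leX XQ]] := separator U.
pose Y := U :\: X.
pose P (W : {set T}) := [&& W \subset Y,
  [forall u in W, forall v in Y, e u v ==> (v \in W)] & #|W| <= t].
have P0 : P set0.
  by rewrite /P sub0set cards0 andbT; apply/forall_inP => u; rewrite inE.
(* [W] is a largest union of components of [Y] with at most [t] vertices. *)
case: (arg_maxnP (fun W : {set T} => #|W|) P0) => W /and3P[WY /forall_inP clW leW] maxW.
have {}clW u v : u \in W -> v \in Y -> e u v -> v \in W.
  by move=> /clW/forall_inP/(_ v) H /H /implyP.
have YU : Y \subset U by apply: subsetDl.
have [YW|] := boolP (Y \subset W).
  exists Y, set0; split; first split; rewrite ?sub0set //.
  - by rewrite disjoint_sym; apply/pred0P => x; rewrite /= inE.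
  - by apply/negP => /touchingP[a [b [_ + _]]]; rewrite inE.
  rewrite cards0 setU0 (leq_trans (subset_leq_card YW)) //; split=> //.
  have -> : U :\: Y = X by rewrite /Y setDDr setDv set0U (setIidPr XU).
  by apply: leq_trans leX _; rewrite leq_mul2r leq_exp2r // leq_mul2r !orbT.
case/subsetPn=> x xY xW.
pose C := component Y x.
have cC : conn C by apply: conn_component.
have xC : x \in C by apply: mem_component.
have CY : C \subset Y by apply: component_sub.
have WC : [disjoint W & C].
  apply/pred0Pn => -[y /andP[/= yW yC]]; case/negP: xW.
  apply: (subsetP (conn_subset cC yC yW _)) xC => u v _ uW vC.
  exact: clW uW (subsetP CY v vC).
(* Otherwise [W :|: C] would be a larger admissible union. *)
have ltWC : t < #|W| + #|C|.
  rewrite ltnNge; apply/negP => leWC; have cardWC : #|W :|: C| = #|W| + #|C|.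
    by apply/eqP; rewrite leq_card_setU.
  suff /maxW : P (W :|: C).
    rewrite cardWC; have : 0 < #|C| by apply/card_gt0P; exists x.
    by clear; lia.
  rewrite /P subUset WY CY cardWC leWC /= andbT; apply/forall_inP => u uWC.
  apply/forall_inP => v vY; apply/implyP => uv; move: uWC; rewrite !in_setU.
  case/orP=> [uW|uC]; first by rewrite (clW u v).
  by rewrite (component_closed uC vY uv) orbT.
have leC := XQ C cC CY.
have C0 : 0 < #|C| by apply/card_gt0P; exists x.
have [||A1 [B1 [[A1C B1C A1B1 nAB] [leA1 leB1 leS1]]]] := IHn C (t - #|W|).
- by move: ltU leC C0; clear; lia.
- by move: ltWC; clear; lia.
have CU := subset_trans CY YU; have WU := subset_trans WY YU.
pose V := Y :\: (W :|: C).
have VY : V \subset Y by apply: subsetDl.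
have VW : [disjoint W & V].
  by rewrite disjoint_sym disjoints_subset /V setDE; apply: subset_trans (subsetIr _ _) _;
     rewrite setCS subsetUl.
have VC : [disjoint V & C].
  by rewrite disjoints_subset /V setDE; apply: subset_trans (subsetIr _ _) _;
     rewrite setCS subsetUr.
exists (W :|: A1), (V :|: B1); split; split.
- by rewrite subUset WU (subset_trans A1C).
- by rewrite subUset (subset_trans VY) // (subset_trans B1C).
- rewrite -setI_eq0 setIUl !setIUr !setU_eq0 !setI_eq0 VW A1B1 andbT /=.
  by rewrite (disjointWr B1C WC) disjoint_sym (disjointWr A1C VC).
- apply/negP => /touchingP[a [b [/setUP[aW|aA] bVB ab]]].
    have bY : b \in Y.
      by case/setUP: bVB => [/(subsetP VY)|/(subsetP B1C)/(subsetP CY)].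
    have bW := clW a b aW bY ab; case/setUP: bVB => [|/(subsetP B1C)].
      by rewrite (disjointFr VW bW).
    by rewrite (disjointFr WC bW).
  case/setUP: bVB => [bV|bB]; last first.
    by case/negP: nAB; apply/touchingP; exists a, b.
  have := component_closed (subsetP A1C a aA) (subsetP VY b bV) ab.
  by rewrite -/C (disjointFr VC bV).
- by apply: leq_trans (leq_card_setU _ _) _; move: leA1 leW; clear; lia.
- apply: leq_trans (leq_card_setU _ _) _.
  have : #|V| + (#|W| + #|C|) <= #|U|.
    have -> : #|W| + #|C| = #|W :|: C| by apply/eqP; rewrite eq_sym leq_card_setU.
    apply: leq_trans (subset_leq_card YU); rewrite addnC -(cardsID (W :|: C) Y).
    by rewrite (setIidPr _) // subUset WY.
  by move: leW leB1 ltWC; clear; lia.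
have subS : U :\: ((W :|: A1) :|: (V :|: B1)) \subset X :|: (C :\: (A1 :|: B1)).
  apply/subsetP => y; rewrite /V /Y !(in_setU, in_setD).
  by do 6!case: (y \in _).
apply: (@leq_trans ((#|X| + #|C :\: (A1 :|: B1)|) ^ 2)).
  rewrite leq_exp2r //; apply: leq_trans (subset_leq_card subS) (leq_card_setU _ _).
move: leX leS1 leC; move: #|C :\: _| #|X| #|C| #|U| => s x' c m; clear.
have -> : (16 * h ^ 2) ^ 2 = 16 * (4 * h ^ 2) ^ 2 by ring.
move: ((4 * h ^ 2) ^ 2) => K leX leS leC.
have leKc : 2 * (K * c) <= K * m by rewrite mulnCA leq_mul2l leC orbT.
have leS' : s ^ 2 <= 16 * (K * c) by rewrite mulnA.
rewrite -mulnA; move: (K * c) (K * m) leX leS' leKc => a b; clear.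
(* The two sides differ by [(3 * x' - s) ^ 2]. As [x' ^ 2 <= b] and [s ^ 2 <= 16 * a <= 8 * b], the
   right side is at most [44 * b], below the [48 * b] required. *)
have : 3 * (x' + s) ^ 2 <= 12 * x' ^ 2 + 4 * s ^ 2.
  by case: (leqP (3 * x') s) => H; nia.
lia.
Qed.

End Bisection.

End Connected.

(** * Discretized drawings of K5 *)

Section K5Parity.

(* Summing over the 15 pairs of disjoint edges of K5, every w occurs twice,
   whereas the 60 values of sg contribute an odd total. *)
Lemma K5_parity (sg : nat -> nat -> bool) (w : nat -> nat -> nat -> bool) :
    (forall i j, i < j < 5 -> sg j i = ~~ sg i j) ->
    (forall i j k l, i < j < 5 -> k < l < 5 -> uniq [:: i; j; k; l] ->
      w i j k (+) w i j l (+) (w k l i (+) w k l j) =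
      sg i k (+) sg i l (+) (sg j k (+) sg j l)) ->
  False.
Proof.
move=> anti wsg.
pose f i j k l := w i j k + w i j l + (w k l i + w k l j)
                  + (sg i k + sg i l + (sg j k + sg j l)).
have even_f i j k l : [&& i < j < 5, k < l < 5 & uniq [:: i; j; k; l]] ->
    ~~ odd (f i j k l).
  by move=> /and3P[ij kl u]; rewrite /f !oddD !oddb wsg // addbb.
pose pairs := [:: (0, 1, (2, 3)); (0, 1, (2, 4)); (0, 1, (3, 4));
  (0, 2, (1, 3)); (0, 2, (1, 4)); (0, 2, (3, 4)); (0, 3, (1, 2)); (0, 3, (1, 4));
  (0, 3, (2, 4)); (0, 4, (1, 2)); (0, 4, (1, 3)); (0, 4, (2, 3));
  (1, 2, (3, 4)); (1, 3, (2, 4)); (1, 4, (2, 3))].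
have : ~~ odd (\sum_(q <- pairs) f q.1.1 q.1.2 q.2.1 q.2.2).
  rewrite big_seq; elim/big_ind: _ => // [m n|q qL].
    by rewrite oddD => /negPf-> /negPf->.
  by apply: even_f; move: q qL; apply/allP.
(* From here on the bits are numbers: replacing each [sg j i] by [1 - sg i j] leaves an odd constant
   and even coefficients. *)
move=> /even_halfK; move: (_./2) => h; rewrite /pairs !big_cons big_nil /f /=.
have {}anti i j : i < j < 5 -> sg j i = 1 - sg i j :> nat.
  by move/anti->; case: (sg i j).
rewrite ?(anti 1 2) ?(anti 1 3) ?(anti 1 4) ?(anti 2 3) ?(anti 2 4) ?(anti 3 4) //.
have sg1 i j : sg i j <= 1 by case: (sg i j).
move: (sg1 1 2) (sg1 1 3) (sg1 1 4) (sg1 2 3) (sg1 2 4) (sg1 3 4).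
(* Without this, lia would split on the 40 booleans. *)
clear; repeat match goal with
  | |- context [nat_of_bool ?b] => move: (nat_of_bool b) => ?
end.
lia.
Qed.

End K5Parity.

(** * Passages of polylines with small steps *)

Section Parity.
Variable R : realFieldType.
Local Open Scope ring_scope.
Implicit Types (a b c d x y : R * R) (s t : seq (R * R)) (eps : R).

(** Breaking ties by height makes distinct points comparable even on a common vertical line. *)
Definition lexlt a b := (a.1 < b.1) || (a.1 == b.1) && (a.2 < b.2).

Definition nearby eps a b := (`|a.1 - b.1| <= eps) && (`|a.2 - b.2| <= eps).

(** This is distance above [4 * eps] in the maximum norm. When both points move by one step, each
    coordinate of their difference changes by at most [2 * eps], so a coordinate that separates them
    keeps its sign. *)
Definition apart eps a b := (4 * eps < `|a.1 - b.1|) || (4 * eps < `|a.2 - b.2|).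

(* Parity of the number of times the polyline x :: s crosses the vertical line
   through c above c. *)
Fixpoint passes_above x s c :=
  if s is y :: s' then
    (lexlt x c (+) lexlt y c) && (c.2 < x.2) (+) passes_above y s' c
  else false.

(** Counterpart of [passes_above]; [a] stands on the left of [lexlt] so that the terms match when
    curve and point exchange roles. *)
Fixpoint passes_below y t a :=
  if t is y' :: t' then
    (lexlt a y (+) lexlt a y') && (y.2 < a.2) (+) passes_below y' t' a
  else false.

Lemma apart_neq eps a b : 0 <= eps -> apart eps a b -> a != b.
Proof.
move=> eps0; apply: contraTneq => ->.
by rewrite /apart !subrr !normr0 orbb -leNgt mulr_ge0.
Qed.

Lemma lexltC a b : a != b -> lexlt b a = ~~ lexlt a b.
Proof.
case: a b => [a1 a2] [b1 b2]; rewrite /lexlt xpair_eqE /=.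
by case: (ltgtP a1 b1) => //= _; case: (ltgtP a2 b2).
Qed.

Lemma lexlt_le a b : lexlt a b -> a.1 <= b.1.
Proof. by case/orP=> [/ltW//|/andP[/eqP->]]. Qed.

Lemma lexltN_le a b : ~~ lexlt a b -> b.1 <= a.1.
Proof. by rewrite /lexlt negb_or -leNgt => /andP[]. Qed.

(** As [x1 <= 0 <= x2], both [x] and [y] are at most [2 * eps] in absolute value. The separation is
    thus in [u] and [v], which are too large to differ in sign. *)
Lemma same_side eps (x1 x2 y1 y2 : R) (x y : R) (u v : R) :
    x1 <= 0 -> 0 <= x2 ->
    `|x1 - x| <= 2 * eps -> `|x2 - x| <= 2 * eps ->
    `|x1 - y| <= 2 * eps -> `|x2 - y| <= 2 * eps ->
    `|u - v| <= 2 * eps ->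
    (4 * eps < `|x|) || (4 * eps < `|u|) -> (4 * eps < `|y|) || (4 * eps < `|v|) ->
  (0 < u) = (0 < v).
Proof.
rewrite !ler_norml !ltr_normr => h1 h2 /andP[h3 h4] /andP[h5 h6] /andP[h7 h8].
move=> /andP[h9 h10] /andP[h11 h12] H1 H2.
have U : 4 * eps < u \/ u < - (4 * eps).
  by case/orP: H1 => /orP[]; [lra|lra|left|right]; lra.
have V : 4 * eps < v \/ v < - (4 * eps).
  by case/orP: H2 => /orP[]; [lra|lra|left|right]; lra.
by apply/idP/idP; case: U; case: V; lra.
Qed.

Lemma nearby_sub eps a a' b b' :
    nearby eps a a' -> nearby eps b b' ->
  `|a.1 - b.1 - (a'.1 - b'.1)| <= 2 * eps /\ `|a.2 - b.2 - (a'.2 - b'.2)| <= 2 * eps.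
Proof.
rewrite /nearby !ler_norml => /andP[/andP[h1 h2] /andP[h3 h4]].
by move=> /andP[/andP[h5 h6] /andP[h7 h8]]; split; apply/andP; split; lra.
Qed.

Lemma nearbyxx eps a : 0 <= eps -> nearby eps a a.
Proof. by move=> eps0; rewrite /nearby !subrr !normr0 eps0. Qed.

Lemma nearby_sym eps a b : nearby eps a b = nearby eps b a.
Proof. by rewrite /nearby [`|a.1 - _|]distrC [`|a.2 - _|]distrC. Qed.


(* Where the lexicographic order of the two curves changes, they are
   horizontally nearby, hence vertically apart apart. *)
Lemma cell_dichotomy eps (L : seq ((R * R) * (R * R))) :
    {in L, forall p, apart eps p.1 p.2} ->
    {in L &, forall p q, nearby eps p.1 q.1 && nearby eps p.2 q.2} ->
  {in L &, forall p q, lexlt p.1 p.2 = lexlt q.1 q.2} \/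
  {in L &, forall p q, (p.2.2 < p.1.2) = (q.2.2 < q.1.2)}.
Proof.
move=> farL clL.
have [/hasP[w1 w1L lt1]|nlt] := boolP (has (fun p => lexlt p.1 p.2) L); last first.
  have n p : p \in L -> lexlt p.1 p.2 = false.
    by move=> pL; apply: contraNF nlt => lt; apply/hasP; exists p.
  by left=> p q pL qL; rewrite !n.
have [/hasP[w2 w2L lt2]|nlt] := boolP (has (fun p => ~~ lexlt p.1 p.2) L); last first.
  have n p : p \in L -> lexlt p.1 p.2.
    by move=> pL; apply: contraNT nlt => lt; apply/hasP; exists p.
  by left=> p q pL qL; rewrite !n.
right=> p q pL qL.
have cl u v : u \in L -> v \in L -> `|u.1.1 - u.2.1 - (v.1.1 - v.2.1)| <= 2 * eps /\
    `|u.1.2 - u.2.2 - (v.1.2 - v.2.2)| <= 2 * eps.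
  by move=> uL vL; have /andP[] := clL u v uL vL; apply: nearby_sub.
have [p1 _] := cl _ _ w1L pL; have [p2 _] := cl _ _ w2L pL.
have [q1 _] := cl _ _ w1L qL; have [q2 _] := cl _ _ w2L qL.
have [_ pq] := cl _ _ pL qL.
rewrite -(subr_gt0 p.2.2) -(subr_gt0 q.2.2).
have le1 : w1.1.1 - w1.2.1 <= 0 by rewrite subr_le0 lexlt_le.
have ge2 : 0 <= w2.1.1 - w2.2.1 by rewrite subr_ge0 lexltN_le.
exact: same_side le1 ge2 p1 p2 q1 q2 pq (farL p pL) (farL q qL).
Qed.

(** By [cell_dichotomy], either the four order bits agree and every term vanishes, or the height
    bits agree and both sides contain the same four order bits. *)
Lemma cell_parity eps x x' y y' :
    0 <= eps -> nearby eps x x' -> nearby eps y y' ->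
    {in [:: x; x'] & [:: y; y'], forall a b, apart eps a b} ->
  (lexlt x y (+) lexlt x' y) && (y.2 < x.2) (+) (lexlt x y' (+) lexlt x' y') && (y'.2 < x.2) =
  (lexlt x y (+) lexlt x y') && (y.2 < x.2) (+) (lexlt x' y (+) lexlt x' y') && (y.2 < x'.2).
Proof.
move=> eps0 xx' yy' farxy.
pose L := [:: (x, y); (x', y); (x, y'); (x', y')].
have farL : {in L, forall p, apart eps p.1 p.2}.
  by move=> p; rewrite !inE => /or4P[]/eqP->; apply: farxy; rewrite !inE eqxx ?orbT.
have clL : {in L &, forall p q, nearby eps p.1 q.1 && nearby eps p.2 q.2}.
  by move=> p q; rewrite !inE => /or4P[]/eqP-> /or4P[]/eqP->;
     rewrite ?nearbyxx //= ?xx' ?yy' // nearby_sym ?xx' ?yy' // nearby_sym.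
have [] := cell_dichotomy farL clL => E.
  have E1 := E (x, y) (x', y); have E2 := E (x, y) (x, y').
  have E3 := E (x, y) (x', y').
  rewrite /L !inE !eqxx !orbT /= in E1 E2 E3.
  by rewrite -(E1 isT isT) -(E2 isT isT) -(E3 isT isT) !addbb.
have E1 := E (x, y) (x', y); have E2 := E (x, y) (x, y').
rewrite /L !inE !eqxx !orbT /= in E1 E2.
rewrite -(E1 isT isT) -(E2 isT isT) -!andb_addl.
by case: (lexlt x y); case: (lexlt x' y); case: (lexlt x y'); case: (lexlt x' y').
Qed.

(** Sum of [cell_parity] over the steps of [t]; the terms at inner vertices of [t] cancel. *)
Lemma strip_parity eps x x' y t :
    0 <= eps -> nearby eps x x' -> path (nearby eps) y t ->
    {in [:: x; x'] & y :: t, forall a b, apart eps a b} ->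
  (lexlt x y (+) lexlt x' y) && (y.2 < x.2) (+)
    (lexlt x (last y t) (+) lexlt x' (last y t)) && ((last y t).2 < x.2) =
  passes_below y t x (+) passes_below y t x'.
Proof.
move=> eps0 xx'; elim: t y => [|y' t IHt] y /=; first by rewrite addbb.
case/andP=> yy' pt farxy.
have farxy' : {in [:: x; x'] & y' :: t, forall a b, apart eps a b}.
  by move=> a b ax bt; apply: farxy => //; rewrite inE bt orbT.
have farc : {in [:: x; x'] & [:: y; y'], forall a b, apart eps a b}.
  move=> a b ax bt; apply: farxy => //.
  by move: bt; rewrite !inE => /orP[]->; rewrite ?orbT.
have := IHt y' pt farxy'; have := cell_parity eps0 xx' yy' farc.
move: (passes_below _ _ _) (passes_below _ _ _) => a b.
move: (_ && _) (_ && _) (_ && _) (_ && _) (_ && _) => c d e f g.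
by case: a b c d e f g => [] [] [] [] [] [] [].
Qed.

(** Sum of [strip_parity] over the steps of [s]; the terms at inner vertices of [s] cancel. *)
Lemma grid_parity eps x s y t :
    0 <= eps -> path (nearby eps) x s -> path (nearby eps) y t ->
    {in x :: s & y :: t, forall a b, apart eps a b} ->
  passes_above x s y (+) passes_above x s (last y t) =
  passes_below y t x (+) passes_below y t (last x s).
Proof.
move=> eps0; elim: s x => [|x' s IHs] x /=; first by rewrite addbb.
case/andP=> xx' ps pt farxy.
have farxy' : {in x' :: s & y :: t, forall a b, apart eps a b}.
  by move=> a b ax bt; apply: farxy => //; rewrite inE ax orbT.
have fars : {in [:: x; x'] & y :: t, forall a b, apart eps a b}.
  move=> a b ax bt; apply: farxy => //.
  by move: ax; rewrite !inE => /orP[]->; rewrite ?orbT.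
have := IHs x' ps pt farxy'; have := strip_parity eps0 xx' pt fars.
move: (passes_below _ _ _) (passes_below _ _ _) (passes_below _ _ _) => a b c.
move: (passes_above _ _ _) (passes_above _ _ _) (_ && _) (_ && _) => d e f g.
by case: a b c d e f g => [] [] [] [] [] [] [].
Qed.

(** Each change of side happens either above or below [a], so the two counts together record all
    changes of side, which telescope to the end points. *)
Lemma passes_below_above eps a y t :
    0 <= eps -> path (nearby eps) y t -> {in y :: t, forall b, apart eps a b} ->
  passes_below y t a (+) passes_above y t a = lexlt a y (+) lexlt a (last y t).
Proof.
move=> eps0; elim: t y => [|y' t IHt] y /=; first by rewrite addbb.
case/andP=> yy' pt fara.
have fara' : {in y' :: t, forall b, apart eps a b}.
  by move=> b bt; apply: fara; rewrite inE bt orbT.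
have := IHt y' pt fara'.
have ay : apart eps a y by apply: fara; rewrite inE eqxx.
have ay' : apart eps a y' by apply: fara; rewrite !inE eqxx orbT.
rewrite (lexltC (apart_neq eps0 ay)) (lexltC (apart_neq eps0 ay')) addbN addNb negbK.
move: (passes_below _ _ _) (passes_above _ _ _) (lexlt a (last _ _)) => u v w.
have [<-|ne] := eqVneq (lexlt a y) (lexlt a y').
  by rewrite addbb /=; case: u v w (lexlt a y) => [] [] [] [].
suff -> : (a.2 < y.2) = ~~ (y.2 < a.2).
  by case: (lexlt a y) ne; case: (lexlt a y') => //= _; case: (y.2 < a.2);
     case: u v w => [] [] [].
rewrite -leNgt lt_neqAle andb_idl // => _.
(* [a.1] lies between the abscissas of [y] and [y'], so [a] and [y] must be apart vertically. *)
have clay : `|a.1 - y.1| <= eps.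
  case/andP: yy'; rewrite !ler_norml => /andP[h1 h2] _.
  case: (boolP (lexlt a y)) ne => [/lexlt_le h3|/lexltN_le h3].
    by case: (boolP (lexlt a y')) => // /lexltN_le h4 _; apply/andP; split; lra.
  by case: (boolP (lexlt a y')) => // /lexlt_le h4 _; apply/andP; split; lra.
case/orP: ay => [|h]; first by move=> h; lra.
apply/eqP => E; move: h; rewrite E subrr normr0; lra.
Qed.

(* Mod 2, this is the intersection number of two curves closed up through
   infinity; it vanishes because the curves are disjoint. *)
Lemma disjoint_curves_parity eps x s y t :
    0 <= eps -> path (nearby eps) x s -> path (nearby eps) y t ->
    {in x :: s & y :: t, forall a b, apart eps a b} ->
  passes_above x s y (+) passes_above x s (last y t) (+)
    (passes_above y t x (+) passes_above y t (last x s)) =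
  lexlt x y (+) lexlt x (last y t) (+) (lexlt (last x s) y (+) lexlt (last x s) (last y t)).
Proof.
move=> eps0 ps pt farxy; rewrite (grid_parity eps0 ps pt farxy).
have farx : {in y :: t, forall b, apart eps x b}.
  by move=> b bt; apply: farxy => //; apply: mem_head.
have farl : {in y :: t, forall b, apart eps (last x s) b}.
  by move=> b bt; apply: farxy => //; apply: mem_last.
rewrite -(passes_below_above eps0 pt farx) -(passes_below_above eps0 pt farl).
by rewrite addbACA.
Qed.

Theorem no_K5_drawing eps (p : nat -> R * R) (w : nat -> nat -> seq (R * R)) :
    0 <= eps ->
    (forall i j, (i < j < 5)%N -> p i != p j) ->
    (forall i j, (i < j < 5)%N -> path (nearby eps) (p i) (w i j) /\ last (p i) (w i j) = p j) ->
    (forall i j k l, (i < j < 5)%N -> (k < l < 5)%N -> uniq [:: i; j; k; l] ->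
      {in p i :: w i j & p k :: w k l, forall a b, apart eps a b}) ->
  False.
Proof.
move=> eps0 p_neq wp farw.
apply: (@K5_parity (fun i j => lexlt (p i) (p j))
                   (fun i j k => passes_above (p i) (w i j) (p k))).
  by move=> i j ij; apply: lexltC; apply: p_neq.
move=> i j k l ij kl uniq_ijkl; have [pij <-] := wp i j ij; have [pkl <-] := wp k l kl.
by apply: disjoint_curves_parity eps0 pij pkl (farw _ _ _ _ ij kl uniq_ijkl).
Qed.

End Parity.

(** * From a clique minor to a drawing of K5 *)

Section DiscreteDrawing.
Variables (R : realFieldType) (T : finType) (e : rel T) (eps : R).
Variables (p : T -> R * R) (w : T -> T -> seq (R * R)).
Hypotheses (p_inj : injective p) (esym : symmetric e) (eps0 : (0 <= eps)%R).
Hypothesis w_path : forall x y, e x y ->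
  path (nearby eps) (p x) (w x y) /\ last (p x) (w x y) = p y.
Hypothesis w_far : forall x y u v, e x y -> e u v ->
  [disjoint [set x; y] & [set u; v]] ->
  {in p x :: w x y & p u :: w u v, forall a b, apart eps a b}.
Implicit Types (A B : {set T}) (F : {set {set T}}).

(** Like [w x y], the list omits its starting point, so that concatenation repeats no junction. *)
Fixpoint trace x (s : seq T) := if s is y :: s' then w x y ++ trace y s' else [::].

Lemma trace_path x s : path e x s ->
  path (nearby eps) (p x) (trace x s) /\ last (p x) (trace x s) = p (last x s).
Proof.
elim: s x => //= y s IHs x /andP[xy ys]; have [pw lw] := w_path xy.
by rewrite cat_path last_cat lw pw; apply: IHs.
Qed.

(** A nonempty [s] ensures that even the starting point [p x] lies on the curve of some edge. *)
Lemma mem_trace A x s a : s != [::] -> path (restr e A) x s -> a \in p x :: trace x s ->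
  exists u v, [/\ e u v, [set u; v] \subset A & a \in p u :: w u v].
Proof.
case: s => // y s _; elim: s x y => [|z s IHs] x y /= /andP[/and3P[xy xA yA] ys].
  rewrite cats0 => ain; exists x, y; split=> //.
  by apply/subsetP => t /set2P[]->.
rewrite inE mem_cat => /or3P[ax|ax|ain].
- exists x, y; split=> //; last by rewrite inE ax.
  by apply/subsetP => t /set2P[]->.
- exists x, y; split=> //; last by rewrite inE ax orbT.
  by apply/subsetP => t /set2P[]->.
- by apply: (IHs y z) => //; rewrite inE; move: ain; rewrite /= => ->; rewrite orbT.
Qed.

Lemma trace_far A B x s y t :
    [disjoint A & B] -> s != [::] -> t != [::] ->
    path (restr e A) x s -> path (restr e B) y t ->
  {in p x :: trace x s & p y :: trace y t, forall a b, apart eps a b}.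
Proof.
move=> AB s0 t0 ps pt a b /(mem_trace s0 ps)[u [v [uv uvA au]]].
move=> /(mem_trace t0 pt)[u' [v' [uv' uvB bu]]].
by apply: (w_far uv uv') => //; apply: disjointWl uvA (disjointWr uvB AB).
Qed.

Lemma restr_path A x s : path (restr e A) x s -> path e x s.
Proof. by apply: sub_path => u v /and3P[]. Qed.

(** Pick a vertex [r i] in each branch set and join [r i] to [r j] inside [C i :|: C j]. Disjoint
    index pairs give walks in disjoint vertex sets, hence curves that are apart, as [no_K5_drawing]
    forbids. *)
Lemma discrete_drawing_no_K5_minor F : minor_model e F -> #|F| <> 5.
Proof.
case=> F0 Fc Fd Ft F5.
pose C i := nth set0 (enum F) i.
have CF i : i < 5 -> C i \in F.
  by move=> i5; rewrite -mem_enum mem_nth // -cardE F5.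
have Cne i j : i < 5 -> j < 5 -> i != j -> C i != C j.
  by move=> i5 j5; rewrite nth_uniq ?enum_uniq // -cardE F5.
have Cd i j : i < 5 -> j < 5 -> i != j -> [disjoint C i & C j].
  by move=> i5 j5 ij; apply: Fd; rewrite ?CF ?Cne.
have [x0 _] : exists x, x \in C 0 by apply/set0Pn; apply: F0; apply: CF.
pose r i := if [pick x in C i] is Some x then x else x0.
have rC i : i < 5 -> r i \in C i.
  move=> i5; rewrite /r; case: pickP => // C0.
  by have /set0Pn[x] := F0 _ (CF i i5); rewrite C0.
have wP i j : exists s, (i < j < 5) ==> [&& path (restr e (C i :|: C j)) (r i) s,
    last (r i) s == r j & s != [::]].
  have [/andP[ij j5]|_] := boolP (i < j < 5); last by exists [::].
  have i5 := ltn_trans ij j5; have ne : i != j by rewrite ltn_eqF.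
  have cU : conn e (C i :|: C j).
    apply: connU_touch => //; [exact/Fc/CF|exact/Fc/CF|].
    by apply: Ft; rewrite ?CF ?Cne.
  have /connectP[s ps ls] : connect (restr e (C i :|: C j)) (r i) (r j).
    by apply: (connP _ _ cU); rewrite inE rC ?orbT.
  exists s; rewrite ps -ls eqxx; case: s ls {ps} => //= ls.
  by have := disjointFr (Cd i j i5 j5 ne) (rC i i5); rewrite -ls rC.
pose s i j := xchoose (wP i j).
have sP i j : i < j < 5 -> [/\ path (restr e (C i :|: C j)) (r i) (s i j),
    last (r i) (s i j) = r j & s i j != [::]].
  by move=> ij; have := xchooseP (wP i j); rewrite -/(s i j) ij => /and3P[? /eqP ? ?].
apply: (@no_K5_drawing R eps (p \o r) (fun i j => trace (r i) (s i j)) eps0).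
- move=> i j /andP[ij j5]; rewrite /= (inj_eq p_inj).
  have i5 := ltn_trans ij j5; have ne : i != j by rewrite ltn_eqF.
  by apply: contraFneq (disjointFr (Cd i j i5 j5 ne) (rC i i5)) => ->; apply: rC.
- move=> i j ij; have [ps ls _] := sP i j ij.
  by have := trace_path (restr_path ps); rewrite ls.
move=> i j k l ij kl; have [ps ls s0] := sP i j ij; have [pt lt t0] := sP k l kl.
rewrite /= !inE !negb_or -!andbA => /and5P[_ ik il jk /andP[jl _]].
apply: trace_far s0 t0 ps pt.
have [/andP[ij' j5] /andP[kl' l5]] := (ij, kl).
rewrite -setI_eq0 setIUl !setIUr !setU_eq0 !setI_eq0.
by rewrite !Cd //; apply: ltn_trans; eassumption.
Qed.

End DiscreteDrawing.

(** * Spanning trees *)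

Section EdgeCount.
Variable T : finType.
Implicit Types (F : {set {set T}}) (W : {set T}) (x y : T) (s : seq T).

Definition join_rel F : rel T := fun x y => [set x; y] \in F.

Definition no_cycle F :=
  forall s, 3 <= size s -> uniq s -> ~~ cycle (join_rel F) s.

Lemma join_rel_sym F : symmetric (join_rel F).
Proof. by move=> x y; rewrite /join_rel setUC. Qed.

Lemma no_cycleS F F' : F' \subset F -> no_cycle F -> no_cycle F'.
Proof.
move=> /subsetP sF nc s s3 us; apply: contra (nc s s3 us).
by case: s {s3 us} => // x s; apply: sub_path => u v /sF.
Qed.

(** The path is extended at its head [x], which lies on an edge other than the one already used;
    acyclicity makes the other end new. *)
Lemma long_path F W x0 n :
    no_cycle F -> {in F, forall A : {set T}, #|A| = 2 /\ A \subset W} -> x0 \in W ->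
    {in W, forall x, 1 < #|[set A in F | x \in A]|} ->
  exists x s, [/\ path (join_rel F) x s, uniq (x :: s), {subset x :: s <= W} & size s = n].
Proof.
move=> nc F2 x0W deg; elim: n => [|n [x [s [px ux sW sz]]]].
  by exists x0, [::]; split=> // x; rewrite inE => /eqP->.
have xW : x \in W by apply: sW; apply: mem_head.
(* If [s] is empty, the default makes the removed set a singleton, which is not an edge. *)
have [A /setD1P[Ane]] : exists A, A \in [set A in F | x \in A] :\ [set x; head x s].
  apply/set0Pn; rewrite -card_gt0; have := deg x xW.
  by rewrite (cardsD1 [set x; head x s]); case: (_ \in _) => //= /ltnW.
rewrite inE => /andP[AF xA]; have [A2 AW] := F2 A AF.
have /cards1P[y Ay] : #|A :\ x| == 1.
  by move: A2; rewrite (cardsD1 x A) xA add1n => -[->].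
have Axy : A = [set x; y] by rewrite -(setD1K xA) Ay.
have yx : y != x by have := set11 y; rewrite -Ay => /setD1P[].
have yW : y \in W by apply: (subsetP AW); rewrite Axy !inE eqxx orbT.
have exy : join_rel F x y by rewrite /join_rel -Axy.
have [ys|ys] := boolP (y \in s).
  (* The path from [x] to [y] would close to a cycle, with at least three vertices because [y] is
     not the head of [s]. *)
  case/splitPr: ys => [s1 s2] in px ux sW sz Ane *.
  have := nc (x :: rcons s1 y); rewrite /= size_rcons rcons_path last_rcons.
  rewrite [join_rel F y x]join_rel_sym exy andbT.
  move: px; rewrite -cat_rcons cat_path => /andP[-> _].
  move: ux; rewrite -cat_rcons -cat_cons cat_uniq /= => /andP[-> _].
  case: s1 Ane sW sz => [|z s1] /= Ane _ _; last by move=> /(_ isT isT).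
  by rewrite Axy eqxx in Ane.
exists y, (x :: s); split=> /=; rewrite ?sz //.
- by rewrite join_rel_sym exy.
- by rewrite inE negb_or yx ys.
- by move=> z; rewrite inE => /orP[/eqP->|/sW].
Qed.

(** Induction by deleting a vertex of degree at most 1; without such a vertex, [long_path] would
    give a path with more than [#|W|] vertices. *)
Lemma forest_card F W :
    no_cycle F -> {in F, forall A : {set T}, #|A| = 2 /\ A \subset W} -> #|F| <= #|W|.
Proof.
have [n] := ubnP #|W|; elim: n W F => // n IHn W F ltW nc F2.
case: (pickP [pred x in W | #|[set A in F | x \in A]| <= 1]) => [x /andP[/= xW deg]|nox].
  rewrite (cardsD1 x W) xW -(cardsID [set A : {set T} | x \in A] F).
  apply: leq_add.
    apply: leq_trans deg; apply: subset_leq_card.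
    by apply/subsetP => A; rewrite !inE.
  apply: IHn; first by move: ltW; rewrite (cardsD1 x W) xW.
    by apply: no_cycleS nc; apply: subsetDl.
  move=> A /setDP[AF]; rewrite inE => xA; have [A2 AW] := F2 A AF; split=> //.
  by apply/subsetP => y yA; rewrite !inE (subsetP AW) // andbT; apply: contraNneq xA => <-.
case: (set_0Vmem W) => [W0|[x0 x0W]].
  suff -> : F = set0 by rewrite cards0.
  apply/setP => A; rewrite inE; apply/negP => /F2[A2].
  by rewrite W0 subset0 => /eqP A0; rewrite A0 cards0 in A2.
have deg : {in W, forall x, 1 < #|[set A in F | x \in A]|}.
  by move=> x xW; rewrite ltnNge; have := nox x; rewrite /= xW /= => ->.
have [x [s [_ us sW sz]]] := long_path #|W| nc F2 x0W deg.
have := uniq_leq_size us (_ : {subset x :: s <= enum W}).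
by rewrite -cardE /= sz ltnn => H; suff : false by []; apply: H => y /sW; rewrite mem_enum.
Qed.

(** A vertex set is grown one vertex at a time, each along an edge that leaves the current set. *)
Lemma connected_card F : (forall x y, connect (join_rel F) x y) -> #|T| <= #|F|.+1.
Proof.
move=> con; have [T0|T0] := posnP #|T|; first by rewrite T0.
have /card_gt0P[x0 _] := T0.
suff [W [Wk leF]] : exists W, #|W| = #|T| /\ #|W| <= #|[set A in F | A \subset W]|.+1.
  rewrite -Wk (leq_trans leF) // ltnS; apply: subset_leq_card.
  by apply/subsetP => A; rewrite inE => /andP[].
rewrite -(prednK T0); have : #|T|.-1 < #|T| by rewrite prednK.
elim: #|T|.-1 => [|k IHk] ltk.
  by exists [set x0]; rewrite cards1.
have [W [Wk leF]] := IHk (ltnW ltk).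
have [x xW] : exists x, x \in W by apply/card_gt0P; rewrite Wk.
have [y yW] : exists y, y \notin W.
  apply/existsP; rewrite -negb_forall; apply: contraTN ltk => /forallP allW.
  by rewrite -leqNgt -Wk; apply: subset_leq_card; apply/subsetP => z _; apply: allW.
have [u [v [uW vW uv]]] : exists u v, [/\ u \in W, v \notin W & join_rel F u v].
  have /connectP[p] := con x y; elim: p x xW => [|z p IHp] x xW /=.
    by move=> _ yx; rewrite yx xW in yW.
  move=> /andP[xz pz] yl; have [zW|zW] := boolP (z \in W); first exact: IHp zW pz yl.
  by exists x, z.
have uvF : [set u; v] \in F := uv.
exists (v |: W); rewrite cardsU1 vW Wk; split=> //.
have sub : [set u; v] |: [set A in F | A \subset W] \subset
    [set A in F | A \subset v |: W].
  rewrite subUset sub1set inE uvF; apply/andP; split.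
    by apply/subsetP => z /set2P[]->; rewrite !inE ?eqxx ?uW ?orbT.
  by apply/subsetP => A; rewrite !inE => /andP[-> AW]; apply: subset_trans AW (subsetUr _ _).
rewrite add1n ltnS; apply: leq_trans (subset_leq_card sub); rewrite cardsU1 inE uvF /=.
have -> /= : ~~ ([set u; v] \subset W).
  by apply/subsetPn; exists v => //; rewrite !inE eqxx orbT.
by rewrite -Wk.
Qed.

End EdgeCount.

(** * Weight of a spanning tree under the labeling of a bisection *)

Section TreeDiscrepancy.
Variable G : sgraph.
Implicit Types (A B : {set G}) (S : subgraph_data G).

Lemma card_edge (e : {set G}) : e \in edges G -> #|e| = 2.
Proof.
rewrite inE => /existsP[x /existsP[y /andP[xy /eqP->]]].
by rewrite cards2; case: eqVneq xy => // ->; rewrite adj_irrefl.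
Qed.

Definition side_labeling B : labeling G := [ffun e : edge G => ~~ [disjoint val e & B]].

Lemma weight_side_labeling B S : is_subgraph S ->
  weight (side_labeling B) S =
  (#|[set A in S.2 | [disjoint A & B]]|%:Z - #|S.2 :\: [set A in S.2 | [disjoint A & B]]|%:Z)%R.
Proof.
move=> /andP[/subsetP SE _].
pose F A : int := ((-1) ^+ (~~ [disjoint A & B]))%R.
have -> : weight (side_labeling B) S = (\sum_(A in S.2) F A)%R.
  transitivity (\sum_(A in edges G | A \in S.2) F A)%R.
    rewrite big_sub_cond; apply: eq_big => // e _.
    by rewrite /F ffunE.
  by apply: eq_bigl => A; case AS: (A \in S.2); rewrite ?andbF // SE.
rewrite (big_setID [set A : {set G} | [disjoint A & B]]) /=; congr (_ + _)%R.
  rewrite (eq_bigr (fun=> 1%R)) => [|A]; last first.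
    by rewrite /F !inE => /andP[_ ->].
  rewrite sumr_const -/(_%:R)%R natz; congr (Posz #|pred_of_set _|).
  by apply/setP => A; rewrite !inE.
rewrite (eq_bigr (fun=> (-1)%R)) => [|A]; last first.
  by rewrite /F !inE => /andP[/negPf-> _]; rewrite expr1.
rewrite sumr_const mulNrn natz; congr (- Posz #|pred_of_set _|)%R.
by apply/setP => A; rewrite !inE; case: (A \in S.2); rewrite ?andbF // !andbT.
Qed.

(** The edges avoiding [B] form a forest on [~: B], those meeting [B] a forest on [~: A], and
    together they number at least [#|G| - 1]. The two truncated differences add up to the absolute
    difference of [#|A|] and [#|B|]. *)
Lemma spanning_tree_weight A B S :
    is_spanning_tree S -> [disjoint A & B] -> ~~ touching (@adj G) A B ->
  `|weight (side_labeling B) S| <= (#|A| - #|B|) + (#|B| - #|A|) + #|~: (A :|: B)| + 1.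
Proof.
case=> subS S1 [_ con] acyc AB nAB.
rewrite (weight_side_labeling _ subS).
have /andP[/subsetP SE _] := subS.
pose F0 := [set e in S.2 | [disjoint e & B]]; pose F1 := S.2 :\: F0.
rewrite -/F0 -/F1.
have F0S : F0 \subset S.2 by apply/subsetP => e; rewrite inE => /andP[].
have F1S : F1 \subset S.2 by apply: subsetDl.
have nc : no_cycle S.2 by [].
have le0 : #|F0| <= #|~: B|.
  apply: forest_card (no_cycleS F0S nc) _ => e; rewrite inE => /andP[eS eB].
  by rewrite card_edge ?SE // -disjoints_subset.
have le1 : #|F1| <= #|~: A|.
  apply: forest_card (no_cycleS F1S nc) _ => e /setDP[eS].
  rewrite inE eS /= => eB; rewrite card_edge ?SE //; split=> //.
  have := SE e eS; rewrite inE => /existsP[x /existsP[y /andP[xy /eqP E]]].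
  rewrite -disjoints_subset; apply: contraR nAB => eA; rewrite {}E in eB eA.
  have [b bB be] : exists2 b, b \in B & b \in [set x; y].
    by case/pred0Pn: eB => b /andP[? ?]; exists b.
  have [a aA ae] : exists2 a, a \in A & a \in [set x; y].
    by case/pred0Pn: eA => a /andP[? ?]; exists a.
  have ab : a != b by apply: contraTneq aA => ->; rewrite (disjointFl AB).
  apply/touchingP; exists a, b; split=> //.
  by move: be ae ab => /set2P[]-> /set2P[]->; rewrite ?eqxx // adj_sym.
have leF : #|G| <= (#|F0| + #|F1|).+1.
  have -> : #|F0| + #|F1| = #|S.2|.
    by rewrite -(cardsID F0 S.2) (setIidPr F0S).
  apply: connected_card => x y; have := con x y; rewrite S1 !inE; exact.
have cA := cardsC A; have cB := cardsC B.
have cAB : #|A :|: B| = #|A| + #|B| by apply/eqP; rewrite leq_card_setU.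
have := cardsC (A :|: B); rewrite cAB.
move: (#|F0|) (#|F1|) le0 le1 leF cA cB => f0 f1; clear; lia.
Qed.

End TreeDiscrepancy.

(** * Plane drawings *)

From mathcomp Require Import all_classical all_reals all_analysis.
Import numFieldNormedType.Exports.
Local Open Scope classical_set_scope.
Local Open Scope ring_scope.

Section Arcs.
Variable R : realType.
Implicit Types (f g : R -> R * R) (eps : R).

Lemma nearby_norm eps (a b : R * R) : nearby eps a b = (`|a - b| <= eps).
Proof. by rewrite prod_normE ge_max. Qed.

Lemma apart_norm eps (a b : R * R) : apart eps a b = (4 * eps < `|a - b|).
Proof. by rewrite prod_normE lt_max. Qed.

(** Uniform continuity on the compact unit interval. *)
Lemma arc_close_steps f eps : 0 < eps -> {within `[0, 1], continuous f} ->
  exists2 n : nat, (0 < n)%N &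
    forall s t, s \in `[0, 1] -> t \in `[0, 1] -> `|s - t| <= n%:R^-1 ->
      nearby eps (f s) (f t).
Proof.
move=> eps0 /subspace_continuousP cf.
pose P (n : nat) (s : R) := s \in `[0, 1] -> forall t, t \in `[0, 1] ->
  `|s - t| <= n.+1%:R^-1 -> nearby eps (f s) (f t).
have [n Pn] : exists n, `[0, 1]%classic `<=` P n.
  have /compact_near_coveringP/near_covering_withinP cov := @segment_compact R 0 1.
  have : \forall n \near \oo, `[0, 1]%classic `<=` P n.
    apply: cov => x xI.
    have /cvgrPdist_lt/(_ (eps / 2)) := cf x xI.
    rewrite divr_gt0 // => /(_ isT) [d /= d0 Hd].
    have d2 : 0 < d / 2 by rewrite divr_gt0.
    near=> z n => zI _ t tI zt.
    have xz : `|x - z| < d / 2.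
      by near: z; exact: (nbhsx_ballx x (d / 2)).
    have nd : n.+1%:R^-1 < d / 2.
      by near: n; exact: (near_infty_natSinv_lt (PosNum d2)).
    have fz : `|f x - f z| < eps / 2.
      by apply: Hd => //=; apply: lt_trans xz _; lra.
    have ft : `|f x - f t| < eps / 2.
      apply: Hd => //=; have -> : x - t = (x - z) + (z - t) by ring.
      by rewrite (le_lt_trans (ler_normD _ _)) // [ltRHS]splitr ltrD // (le_lt_trans zt).
    rewrite nearby_norm; have -> : f z - f t = (f x - f t) - (f x - f z).
      by rewrite opprB [RHS]addrC addrA subrK.
    by apply: le_trans (ler_normB _ _) _; rewrite [leRHS]splitr lerD ?ltW.
  by case=> n _ Hn; exists n; apply: Hn => /=.
exists n.+1 => // s t sI tI st; exact: (Pn s sI sI t tI st).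
Unshelve. all: by end_near.
Qed.

(** The distance attains a positive minimum on the product of the two compact images; half of it is
    a strict bound. *)
Lemma disjoint_arcs_apart f g :
    {within `[0, 1], continuous f} -> {within `[0, 1], continuous g} ->
    {in `[0, 1] &, forall s t, f s <> g t} ->
  exists2 d, 0 < d & {in `[0, 1] &, forall s t, d < `|f s - g t|}.
Proof.
move=> cf cg fg.
pose K := (f @` `[0, 1]) `*` (g @` `[0, 1]).
have cK : compact K.
  by apply: compact_setX; apply: continuous_compact => //; apply: segment_compact.
have I0 : (0 : R) \in `[0, 1] by rewrite in_itv /= lexx ler01.
have K0 : K !=set0 by exists (f 0, g 0); split => /=; exists 0.
have cn : continuous (fun z : (R * R) * (R * R) => `|z.1 - z.2|).
  move=> z; apply: cvg_norm; apply: cvgB; [exact: cvg_fst|exact: cvg_snd].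
have [z] := compact_EVT_min K0 cK (continuous_subspaceT cn).
rewrite inE => -[[s /= sI fs] [t /= tI gt]] zmin.
have z0 : 0 < `|z.1 - z.2| by rewrite normr_gt0 subr_eq0 -fs -gt; apply/eqP/fg.
exists (`|z.1 - z.2| / 2); first by rewrite divr_gt0.
move=> u v uI vI; have := zmin (f u, g v); rewrite inE => /(_ _).
move=> H; apply: lt_le_trans (H _); first by lra.
by split => /=; [exists u | exists v].
Qed.

(** The minimum of the finitely many thresholds works; the base value 1 keeps it positive when [I]
    is empty. *)
Lemma finite_pos_bound (I : finType) (P : I -> R -> Prop) :
    (forall i, exists2 d, 0 < d & forall eps, 0 < eps <= d -> P i eps) ->
  exists2 eps, 0 < eps & forall i, P i eps.
Proof.
move=> exd; pose d i := s2val (cid2 (exd i)).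
have dP i : 0 < d i /\ forall eps, 0 < eps <= d i -> P i eps.
  by rewrite /d; case: (cid2 (exd i)).
exists (\big[Num.min/1]_i d i).
  by apply/bigmin_gtP; split=> // i _; have [] := dP i.
move=> i; have [d0 Pi] := dP i; apply: Pi; rewrite bigmin_le_cond // andbT.
by apply/bigmin_gtP; split=> // j _; have [] := dP j.
Qed.
End Arcs.

(** * Polylines along the edges of a plane drawing *)

Section PlaneDrawing.
Variables (R : realType) (G : sgraph) (p : G -> R * R) (arc : edge G -> R -> R * R).
Hypothesis drawn : is_plane_drawing p arc.

Lemma unit_itv_cases (t : R) : t \in `[0, 1] -> [\/ t \in `]0, 1[, t = 0 | t = 1].
Proof.
rewrite !in_itv /= => /andP[]; rewrite !le_eqVlt => /predU1P[<-|t0]; first by constructor 2.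
by move=> /predU1P[->|t1]; [constructor 3 | constructor 1; rewrite t0].
Qed.

Lemma arc_end (e : edge G) (t : R) : t = 0 \/ t = 1 -> exists2 x, x \in val e & arc e t = p x.
Proof.
case: drawn => _ _ ends _ _ t01.
have : [set arc e 0; arc e 1] (arc e t) by case: t01 => ->; [left|right].
by rewrite -ends => -[x xe px]; exists x.
Qed.

(** A common point is either interior to one of the arcs, which a drawing forbids, or the image of
    an end of both edges, which injectivity of [p] forbids. *)
Lemma disjoint_edges_arcs (e e' : edge G) : [disjoint val e & val e']%B ->
  {in `[0, 1] &, forall s t, arc e s <> arc e' t}.
Proof.
case: drawn => p_inj _ _ avoid cross dis s t /unit_itv_cases sI /unit_itv_cases tI st.
have ends (u : R) : [\/ u \in `]0, 1[, u = 0 | u = 1] -> (u \in `]0, 1[) \/ (u = 0 \/ u = 1).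
  by case; [left|right; left|right; right].
have [x0 x0e px0] := arc_end e (or_introl erefl).
case: (ends s sI) => [sO|/(arc_end e)[x xe px]].
  case: (ends t tI) => [tO|/(arc_end e')[y ye py]].
    apply: cross sO tO st; apply: contraTneq dis => <-.
    by apply/pred0Pn; exists x0; rewrite /= x0e.
  by apply: (avoid e y s sO); rewrite st.
case: (ends t tI) => [tO|/(arc_end e')[y ye py]].
  by apply: (avoid e' x t tO); rewrite -st.
have xy : x = y by apply: p_inj; rewrite -px -py.
by rewrite -xy (disjointFr dis xe) in ye.
Qed.

Lemma path_map_iota (T : Type) (r : rel T) (f : nat -> T) m n :
  (forall k, (m <= k < m + n)%N -> r (f k) (f k.+1)) ->
  path r (f m) (map f (iota m.+1 n)) /\ last (f m) (map f (iota m.+1 n)) = f (m + n)%N.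
Proof.
elim: n m => [|n IHn] m rf /=; first by rewrite addn0.
have [|pf lf] := IHn m.+1; first by move=> k /andP[mk kn]; apply: rf; lia.
by rewrite rf ?pf ?lf ?addSnnS //; lia.
Qed.

(** The arc is sampled at multiples of [1 / n], forward or backward, since a drawing does not fix
    which end is [arc e 0]. *)
Lemma edge_polyline (e : edge G) eps x y : 0 < eps -> val e = [set x; y]%SET -> x != y ->
  exists s, [/\ path (nearby eps) (p x) s, last (p x) s = p y
    & forall a, a \in p x :: s -> exists2 t, t \in `[0, 1] & a = arc e t].
Proof.
case: drawn => p_inj arcs ends avoid cross eps0 exy xy.
have [cont inj] := arcs e.
have [n n0 step] := arc_close_steps eps0 cont.
have nR : 0 < n%:R :> R by rewrite ltr0n.
pose fwd k := arc e (k%:R / n%:R); pose bwd k := arc e ((n - k)%N%:R / n%:R).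
have kI k : (k <= n)%N -> k%:R / n%:R \in `[0 : R, 1].
  by move=> kn; rewrite in_itv /= divr_ge0 // ler_pdivrMr // mul1r ler_nat.
have kS k : `|k%:R / n%:R - k.+1%:R / n%:R| <= n%:R^-1 :> R.
  rewrite -mulrBl -natr1 opprD addrA subrr add0r mulN1r normrN ger0_norm //.
have n1 : n%:R / n%:R = 1 :> R by rewrite divff // gt_eqF.
suff [f [f0 fn fs fr]] : exists f : nat -> R * R, [/\ f 0%N = p x, f n = p y,
    forall k, (k < n)%N -> nearby eps (f k) (f k.+1)
    & forall k, (k <= n)%N -> exists2 t, t \in `[0, 1] & f k = arc e t].
  have [|ps ls] := @path_map_iota _ (nearby eps) f 0 n.
    by move=> k /andP[_ kn]; apply: fs.
  exists (map f (iota 1 n)); rewrite -f0; split=> //; first by rewrite ls add0n.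
  move=> a; rewrite inE => /predU1P[->|/mapP[k]]; first exact: fr.
  by rewrite mem_iota => /andP[_ kn] ->; apply: fr; lia.
have ends_xy : (arc e 0 = p x /\ arc e 1 = p y) \/ (arc e 0 = p y /\ arc e 1 = p x).
  have in_ends z : z \in val e -> p z = arc e 0 \/ p z = arc e 1.
    move=> ze; have : (p @` [set z | z \in val e]) (p z) by exists z.
    by rewrite ends.
  have pxy : p x <> p y by move=> /p_inj/eqP; rewrite (negPf xy).
  have [|px|px] := in_ends x; first by rewrite exy !inE eqxx.
    have [|py|py] := in_ends y; first by rewrite exy !inE eqxx orbT.
      by case: pxy; rewrite px py.
    by left.
  have [|py|py] := in_ends y; first by rewrite exy !inE eqxx orbT.
    by right.
  by case: pxy; rewrite px py.
case: ends_xy => -[e0 e1].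
  exists fwd; split.
  - by rewrite /fwd mul0r.
  - by rewrite /fwd n1.
  - by move=> k kn; apply: step; rewrite ?kI //; lia.
  - by move=> k kn; exists (k%:R / n%:R); rewrite ?kI.
exists bwd; split.
- by rewrite /bwd subn0 n1.
- by rewrite /bwd subnn mul0r.
- move=> k kn; apply: step; rewrite ?kI //; try lia.
  by rewrite distrC (_ : n - k = (n - k.+1).+1)%N ?kS //; lia.
- by move=> k kn; exists ((n - k)%N%:R / n%:R); rewrite ?kI //; lia.
Qed.

End PlaneDrawing.

(** One [eps] serves all pairs of disjoint edges: [4 * eps] is below the distance of their arcs, and
    [eps] bounds the steps of the sampled polylines. *)
Lemma planar_no_K5_minor (R : realType) (G : sgraph) (F : {set {set G}}) :
  planar R G -> minor_model (@adj G) F -> #|F| <> 5%N.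
Proof.
move=> [p [arc drawn]]; have [p_inj arcs _ _ _] := drawn.
pose P (ee : edge G * edge G) eps := [disjoint val ee.1 & val ee.2]%B ->
  {in `[0, 1] &, forall s t, 4 * eps < `|arc ee.1 s - arc ee.2 t|}.
have [[e e']|eps eps0 epsP] := @finite_pos_bound R _ P.
  rewrite /P /=; case: (boolP [disjoint val e & val e']%B) => [dis|_]; last by exists 1.
  have [d d0 dP] := disjoint_arcs_apart (arcs e).1 (arcs e').1 (disjoint_edges_arcs drawn dis).
  exists (d / 4); first by rewrite divr_gt0.
  move=> eps /andP[_ led] _ s t sI tI; apply: le_lt_trans (dP s t sI tI).
  by rewrite mulrC -ler_pdivlMr.
have edgeP x y : adj x y -> [set x; y]%SET \in edges G.
  by move=> xy; rewrite inE; apply/existsP; exists x; apply/existsP; exists y; rewrite xy eqxx.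
pose E x y xy : edge G := exist (fun e => e \in edges G) _ (edgeP x y xy).
(* The edge [E x y xy] carries a proof of adjacency; as that proof is unique, [s] can be chosen from
   [x] and [y] alone. *)
have wP x y : exists s, forall xy : adj x y,
    [/\ path (nearby eps) (p x) s, last (p x) s = p y
      & forall a, a \in p x :: s ->
          exists2 t, t \in `[0, 1] & a = arc (E x y xy) t].
  have [xy|nxy] := pselect (adj x y); last by exists [::] => xy; case: nxy.
  have ne : x != y by apply: contraTneq xy => ->; rewrite adj_irrefl.
  have [s sP] := edge_polyline drawn (e := E x y xy) eps0 erefl ne.
  by exists s => xy'; rewrite (bool_irrelevance xy' xy).
pose w x y := projT1 (cid (wP x y)).
have wE x y (xy : adj x y) : [/\ path (nearby eps) (p x) (w x y), last (p x) (w x y) = p y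
      & forall a, a \in p x :: w x y ->
          exists2 t, t \in `[0, 1] & a = arc (E x y xy) t].
  by rewrite /w; case: (cid _).
apply: (@discrete_drawing_no_K5_minor R G (@adj G) eps p w) => //.
- exact: adj_sym.
- exact: ltW.
- by move=> x y xy; have [] := wE x y xy.
move=> x y u v xy uv dis a b; have [_ _ wa] := wE x y xy; have [_ _ wb] := wE u v uv.
move=> /wa[s sI ->] /wb[t tI ->]; rewrite apart_norm.
exact: (epsP (E x y xy, E u v uv) dis s t sI tI).
Qed.

(** The additive 2 is absorbed because [sqrt n] is at least 1. *)
Lemma ler_sqrt_bound (R : realType) (k s n d : nat) :
    (s ^ 2 <= k ^ 2 * n)%N -> (d <= 2 * s + 2)%N -> (1 <= n)%N ->
  d%:R <= (2 * k + 2)%N%:R * Num.sqrt (n%:R : R).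
Proof.
move=> les led n0.
have sR : s%:R <= k%:R * Num.sqrt (n%:R : R).
  have -> : k%:R = Num.sqrt (k%:R ^+ 2) :> R by rewrite sqrtr_sqr ger0_norm.
  rewrite -sqrtrM ?sqr_ge0 // -[s%:R]ger0_norm // -sqrtr_sqr ler_wsqrtr //.
  by rewrite -!natrX -natrM ler_nat.
have n1 : 1 <= Num.sqrt (n%:R : R) by rewrite -[leLHS]sqrtr1 ler_wsqrtr // ler1n.
apply: (@le_trans _ _ (2 * s + 2)%N%:R); first by rewrite ler_nat.
rewrite [(2 * s + 2)%N%:R]natrD [(2 * k + 2)%N%:R]natrD !natrM; lra.
Qed.

Theorem theorem1p4 (R : realType) :
  exists c : R, 0 < c /\
    forall (n : nat) (G : sgraph), (1 <= n)%N -> #|G| = n -> planar R G ->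
      (discrepancy (spanning_trees G))%:R <= c * Num.sqrt (n%:R : R).
Proof.
(* This is [2 * k + 2] for the constant [k = 16 * h ^ 2] of [bisection] with [h = 5]. *)
exists (2 * (16 * 5 ^ 2) + 2)%N%:R; split; first by rewrite ltr0n addn2.
move=> n G n0 cardG planarG.
have no5 F : minor_model (@adj G) F -> #|F| <> 5 by apply: planar_no_K5_minor planarG.
have [|A [B [[_ _ AB nAB] [leA leB]]]] :=
  @bisection _ _ (@adj_sym G) 5 isT no5 [set: G]%SET (n %/ 2).
  by rewrite cardsT cardG leq_div.
rewrite cardsT cardG finset.setTD in leB *; set s := #|_| => les.
(* With [t = n %/ 2], the sizes of [A] and [B] differ by at most [s + 1], the 1 coming from odd [n];
   [spanning_tree_weight] adds another [s + 1]. *)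
have disc : (discrepancy (spanning_trees G) <= 2 * s + 2)%N.
  apply/discrepancy_leP; exists (side_labeling B) => S; rewrite inE => /asboolP treeS.
  apply: leq_trans (spanning_tree_weight treeS AB nAB) _.
  have := cardsC (A :|: B)%SET; rewrite -/s cardG.
  have -> : #|A :|: B|%SET = (#|A| + #|B|)%N by apply/eqP; rewrite leq_card_setU.
  by move: leA leB; clear; lia.
exact: ler_sqrt_bound les disc n0.
Qed.
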